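(* Let $M$ be a finite-dimensional manifold of class $C^2$ and let $g$ be a $C^1$ Riemannian metric on $M$. Let $C_0$ and $r_0$ be positive constants with $0<C_0<\infty$ and $0<r_0\le\infty$, let $x_0\in\mathbb{R}^q$, and let $f:B_{\mathrm{Euc}}(x_0,r_0)\to M$ be a map of class $C^1$ on the Euclidean ball $B_{\mathrm{Euc}}(x_0,r_0)\subset\mathbb{R}^q$, whose differential (tangent map) $df(x):\mathbb{R}^q\to T_{f(x)}M$ satisfies $$df(x)\bigl(B_{\mathrm{Euc}}(0,C_0)\bigr)\supseteq\{\xi\in T_{f(x)}M:\ g(\xi,\xi)\le 1\}\qquad\text{for all }x\in B_{\mathrm{Euc}}(x_0,r_0).$$ Then $$f\bigl(B_{\mathrm{Euc}}(x_0,r_0)\bigr)\supseteq B_{\mathrm{Rie}}\Bigl(f(x_0),\frac{r_0}{2C_0}\Bigr).$$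
   Context: $B_{\mathrm{Euc}}(x,r)$ denotes the (open) Euclidean ball in $\mathbb{R}^q$ of center $x$ and radius $r$; $B_{\mathrm{Euc}}(x_0,\infty)=\mathbb{R}^q$. $T_zM$ is the tangent space to $M$ at $z$. $B_{\mathrm{Rie}}(z,r)$ denotes the (open) ball in $M$ of center $z$ and radius $r$ with respect to the Riemannian distance generated by $g$, i.e. the infimum of the $g$-lengths of absolutely continuous paths joining two points (equal to $+\infty$ if there is no such path). If $r_0=\infty$, then $\frac{r_0}{2C_0}=\infty$ and $B_{\mathrm{Rie}}(z,\infty)$ is the set of points at finite Riemannian distance from $z$ (all of $M$ when $M$ is connected). *)

(* Defs.v *)
From HB Require Import structures.
From mathcomp Require Import all_boot all_order all_algebra.
From mathcomp Require Import all_classical all_reals all_analysis.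
Import Order.TTheory GRing.Theory Num.Theory.
Import numFieldNormedType.Exports.

Set Implicit Arguments.
Unset Strict Implicit.
Unset Printing Implicit Defensive.

Local Open Scope classical_set_scope.
Local Open Scope ring_scope.

(* The library norm on 'rV[R]_m is the sup norm; it induces the usual topology
   and differentials, but Euclidean balls need their own norm. *)
Definition eucl_norm (R : realType) (m : nat) (v : 'rV[R]_m) : R :=
  Num.sqrt (\sum_(i < m) v ord0 i ^+ 2).

Definition eucl_ball (R : realType) (m : nat) (x : 'rV[R]_m) (r : \bar R) :
    set 'rV[R]_m :=
  [set y | ((eucl_norm (y - x))%:E < r)%E].

(* Class C^k on an open set U. Testing x |-> 'd F x v for each fixed v is enough
   because the source is finite-dimensional. *)
Fixpoint class_C (R : realType) (m : nat) (W : normedModType R) (k : nat)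
    (U : set 'rV[R]_m) (F : 'rV[R]_m -> W) {struct k} : Prop :=
  match k with
  | 0%N => forall x, U x -> {for x, continuous F}
  | k'.+1 => (forall x, U x -> differentiable F x) /\
             (forall v : 'rV[R]_m, class_C k' U (fun x => 'd F x v))
  end.

(* Absolute continuity on [s, t]; the finite families are made of subintervals
   with pairwise disjoint interiors. *)
Definition abs_continuous (R : realType) (m : nat) (s t : R)
    (F : R -> 'rV[R]_m) : Prop :=
  forall e : R, 0 < e -> exists2 d : R, 0 < d &
    forall (N : nat) (a b : 'I_N -> R),
      (forall k, [/\ s <= a k, a k <= b k & b k <= t]) ->
      trivIset [set: 'I_N] (fun k => `]a k, b k[%classic) ->
      \sum_(k < N) (b k - a k) < d ->
      \sum_(k < N) eucl_norm (F (b k) - F (a k)) < e.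

(* Hausdorff n-dimensional manifold of class C^2, given by an atlas. Only the
   values of [coord i] on [dom i], and of [param i] (the inverse chart) on
   [coord i @` dom i], are meaningful. *)
Record manifold (R : realType) (n : nat) := Manifold {
  carrier :> topologicalType ;
  hausdorff_carrier : hausdorff_space carrier ;
  index : Type ;
  dom : index -> set carrier ;
  coord : index -> carrier -> 'rV[R]_n ;
  param : index -> 'rV[R]_n -> carrier ;
  dom_cover : forall p : carrier, exists i, dom i p ;
  dom_open : forall i, open (dom i) ;
  coord_open : forall i, open (coord i @` dom i) ;
  coordK : forall i p, dom i p -> param i (coord i p) = p ;
  coord_continuous : forall i p, dom i p -> {for p, continuous (coord i)} ;
  param_continuous : forall i x,
    (coord i @` dom i) x -> {for x, continuous (param i)} ;
  transition_C2 : forall i j,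
    class_C 2 (coord i @` (dom i `&` dom j)) (coord j \o param i)
}.

Section Tangent.
Variables (R : realType) (n : nat) (M : manifold R n).

(* A tangent vector at p is the family of its components in all the charts at p,
   related by the differentials of the transition maps; components in charts
   not containing p are set to 0, so that such a family is unique. *)
Definition tangent_family := index M -> 'rV[R]_n.

Definition tangent_space (p : M) : set tangent_family :=
  [set xi | (forall i j, dom i p -> dom j p ->
               xi j = 'd (coord j \o param i) (coord i p) (xi i)) /\
            (forall i, ~ dom i p -> xi i = 0)].

Definition family_at (p : M) (xi : tangent_family) : tangent_family :=
  fun j => if p \in dom j then xi j else 0.

(* The tangent vector at p with components v in the chart i. *)
Definition chart_vector (i : index M) (p : M) (v : 'rV[R]_n) : tangent_family :=
  family_at p (fun j => 'd (coord j \o param i) (coord i p) v).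

(* A C^1 Riemannian metric; the values of [inner p] off [tangent_space p] are
   irrelevant. The last field says that the functions g_{ab} are C^1 in every
   chart. *)
Record riemannian_metric := RiemannianMetric {
  inner :> M -> tangent_family -> tangent_family -> R ;
  inner_sym : forall p xi eta, tangent_space p xi -> tangent_space p eta ->
    inner p xi eta = inner p eta xi ;
  inner_linear : forall p (a : R) xi xi' eta, tangent_space p xi ->
    tangent_space p xi' -> tangent_space p eta ->
    inner p (fun j => a *: xi j + xi' j) eta
      = a * inner p xi eta + inner p xi' eta ;
  inner_pos : forall p xi, tangent_space p xi -> (exists j, xi j <> 0) ->
    0 < inner p xi xi ;
  inner_C1 : forall i (v w : 'rV[R]_n),
    @class_C R n R^o 1 (coord i @` dom i)
      (fun x => inner (param i x) (chart_vector i (param i x) v)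
                                  (chart_vector i (param i x) w))
}.

Definition map_C1 (q : nat) (B : set 'rV[R]_q) (f : 'rV[R]_q -> M) : Prop :=
  (forall x, B x -> {for x, continuous f}) /\
  (forall i, class_C 1 (B `&` f @^-1` dom i) (coord i \o f)).

Definition tangent_map (q : nat) (f : 'rV[R]_q -> M) (x h : 'rV[R]_q) :
    tangent_family :=
  family_at (f x) (fun j => 'd (coord j \o f) x h).

Definition abs_continuous_path (c : R -> M) : Prop :=
  {within `[0, 1], continuous c} /\
  (forall i (s t : R), 0 <= s -> s <= t -> t <= 1 ->
     (forall u, s <= u <= t -> dom i (c u)) ->
     abs_continuous s t (coord i \o c)).

(* For an absolutely continuous path this is the velocity at almost every time
   of [0, 1]; its values elsewhere do not affect the length. *)
Definition velocity (c : R -> M) (t : R) : tangent_family :=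
  family_at (c t) (fun j => derive1 (coord j \o c) t).

Definition path_length (g : riemannian_metric) (c : R -> M) : \bar R :=
  (\int[lebesgue_measure]_(t in `[0%R, 1%R])
     (Num.sqrt (g (c t) (velocity c t) (velocity c t)))%:E)%E.

Definition riemannian_distance (g : riemannian_metric) (p p' : M) : \bar R :=
  ereal_inf [set path_length g c | c in
    [set c | [/\ abs_continuous_path c, c 0 = p & c 1 = p']]].

Definition riemannian_ball (g : riemannian_metric) (z : M) (r : \bar R) : set M :=
  [set y | (riemannian_distance g z y < r)%E].

End Tangent.

(* Main.v *)
Require Import Defs.
From HB Require Import structures.
From mathcomp Require Import all_boot all_order all_algebra finmap.
From mathcomp Require Import all_classical all_reals all_analysis.
From mathcomp Require Import measurable_realfun.
From mathcomp Require Import lra ring.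
Require Import Defs.
Import Order.TTheory GRing.Theory Num.Theory.
Import numFieldNormedType.Exports.

Set Implicit Arguments.
Unset Strict Implicit.
Unset Printing Implicit Defensive.

Local Open Scope classical_set_scope.
Local Open Scope ring_scope.

(** The proof lifts a short path of M through f.

    Let y lie in the Riemannian ball; some path c from f x0 to y has length
    less than r0 / (2 C0). Call t in [0, 1] liftable if c t = f x for some x
    whose distance to x0 is at most 2 C0 times the length of c on [0, t]; all
    these x lie in a fixed compact ball contained in the domain of f. The time
    0 is liftable, and the supremum of the liftable times is liftable, by
    compactness of that ball, continuity of f and c, and separation of M
    ([lift_set_closed]). A liftable time t < 1 is never maximal
    ([lift_step]), so 1 is liftable, which is the claim.

    In [lift_step] one works in a chart at c t = f x, with A the matrix of the
    metric at that point; nearby, the metric agrees with A up to a factor 5/4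
    ([near_gram_le]), so the hypothesis on df says that every vector d is the
    image of a vector of Euclidean norm at most (5/4) C0 |d|_A. Two facts are
    combined. First, such a map reaches every target w close to F x from a
    point at distance at most (3/2) C0 |w - F x|_A of x
    ([local_covering]): minimise |w - F z|_A + |z - x| / k over a closed ball,
    where k = (3/2) C0; if F z were not w, a small step along a preimage of w - F z would decrease
    this quantity. Only differentiability of F is needed, and
    there is no differential equation to solve. Secondly, the increment of c
    in the chart is at most 5/4 times the length of c on the same interval
    ([chart_increment_le]). Since (3/2)(5/4) < 2, the loss is covered by the
    factor 2 of the statement.

    The bound on the increment is the fundamental theorem of calculus for
    absolutely continuous functions ([ac_FTC]): such a function is the
    difference of two nondecreasing absolutely continuous ones, its total
    variation and the remainder; the Lebesgue-Stieltjes measure of each is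
    dominated by the Lebesgue measure ([ac_dominates]), so the Radon-Nikodym
    theorem gives a density, and Lebesgue differentiation identifies it with
    the derivative almost everywhere. The speed of c is not known to be
    measurable for the Borel sets, so its integral is treated as a lower
    integral: monotone ([ge0_le_integral_nomeas]) and superadditive in the
    domain ([ge0_integral_superadditive]), which is all that is used. *)

(** * Absolutely continuous functions of a real variable *)

Section absolute_continuity.
Variable R : realType.
Implicit Types (G H : R -> R) (L : seq (R * R)) (i : interval R).

(** [L] lists, in any order, the endpoints [(p.1, p.2)] of subintervals of [i],
    possibly reduced to a point, such that of any two of them one ends before
    the other begins. *)
Definition disjoint_itvs i L :=
  all (fun p : R * R => [&& p.1 \in i, p.2 \in i & p.1 <= p.2]) L &&
  pairwise (fun p q : R * R => (p.2 <= q.1) || (q.2 <= p.1)) L.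

(** Absolute continuity of a real function on the interval [i], which may be
    unbounded. Lists of intervals rather than indexed families make it easy to
    split one interval into several. *)
Definition acfun i G := forall e : R, 0 < e -> exists2 d : R, 0 < d &
  forall L, disjoint_itvs i L -> \sum_(p <- L) (p.2 - p.1) < d ->
    \sum_(p <- L) `|G p.2 - G p.1| <= e.

(** The nearest point of [[a, b]] to [x]. *)
Definition clamp (a b x : R) := Num.min b (Num.max a x).

Lemma clamp_itv a b x : a <= b -> clamp a b x \in `[a, b].
Proof.
move=> ab; rewrite in_itv/= /clamp.
by rewrite le_min ab le_max lexx/= ge_min lexx.
Qed.

Lemma clamp_id a b x : x \in `[a, b] -> clamp a b x = x.
Proof.
rewrite in_itv/= => /andP[ax xb]; rewrite /clamp.
by rewrite (max_idPr ax) (min_idPr xb).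
Qed.

Lemma le_clamp a b x y : x <= y -> clamp a b x <= clamp a b y.
Proof. move=> xy; rewrite /clamp !minEle !maxEle; do !case: ifPn; rewrite -?ltNge; lra. Qed.

Lemma clamp_lip a b x y : a <= b -> x <= y -> clamp a b y - clamp a b x <= y - x.
Proof. move=> ab xy; rewrite /clamp !minEle !maxEle; do !case: ifPn; rewrite -?ltNge; lra. Qed.

(** Precomposition with [clamp a b] extends a function from [[a, b]] to the
    whole line by constants, preserving absolute continuity. *)
Lemma ac_clamp a b G : a <= b -> acfun `[a, b] G -> acfun `]-oo, +oo[ (G \o clamp a b).
Proof.
move=> ab acG e e0; have [d d0 Gd] := acG e e0; exists d => // L /andP[L1 L2] Ld.
pose h (p : R * R) := (clamp a b p.1, clamp a b p.2).
have := Gd (map h L); rewrite !big_map/=; apply; last first.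
  apply: le_lt_trans Ld; rewrite !big_seq; apply: ler_sum => p pL.
  by move/allP: L1 => /(_ _ pL) /and3P[_ _]; exact: clamp_lip.
rewrite /disjoint_itvs; apply/andP; split.
  apply/allP => _ /mapP[p pL ->]/=; rewrite !clamp_itv//=.
  by move/allP: L1 => /(_ _ pL) /and3P[_ _]; exact: le_clamp.
rewrite pairwise_map; apply: sub_pairwise L2 => p q /= /orP[] pq.
  by rewrite le_clamp.
by apply/orP; right; rewrite le_clamp.
Qed.

Lemma acB i G H : acfun i G -> acfun i H -> acfun i (fun x => G x - H x).
Proof.
move=> acG acH e e0; have e20 : 0 < e / 2 by rewrite divr_gt0.
have [d d0 Gd] := acG _ e20; have [d' d'0 Hd'] := acH _ e20.
exists (Num.min d d') => [|L iL]; first by rewrite lt_min d0.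
rewrite lt_min => /andP[Ld Ld'].
rewrite (splitr e) (le_trans _ (lerD (Gd L iL Ld) (Hd' L iL Ld')))//.
rewrite -big_split/=; apply: ler_sum => p _.
by rewrite opprD addrACA -opprD ler_normB.
Qed.

Lemma ac_continuous G : acfun `]-oo, +oo[ G -> continuous G.
Proof.
move=> acG x; apply/cvgrPdist_le => e e0; have [d d0 Gd] := acG e e0.
have {}Gd u v : u <= v -> v - u < d -> `|G v - G u| <= e.
  move=> uv vud; have := Gd [:: (u, v)]; rewrite !big_seq1/=; apply => //.
  by rewrite /disjoint_itvs/= uv.
exists d => //= y; rewrite /ball_/=; have [xy|yx] := leP x y.
  rewrite distrC ger0_norm ?subr_ge0// => xyd; rewrite distrC; exact: Gd.
by rewrite ger0_norm ?subr_ge0 ?(ltW yx)// => xyd; apply: Gd => //; exact: ltW.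
Qed.

(** [zip (belast a s) s] is the list of the pairs of consecutive points of the
    partition [a :: s]. *)
Lemma partition_disjoint_itvs i a b s : a \in i -> b \in i ->
  itv_partition a b s ->
  disjoint_itvs i (zip (belast a s) s) /\
  all (fun p : R * R => (a <= p.1) && (p.2 <= b)) (zip (belast a s) s) /\
  \sum_(p <- zip (belast a s) s) (p.2 - p.1) = b - a.
Proof.
elim: s a => [a ai bi /itv_partition_nil ->|x s IH a ai bi abs].
  by rewrite /= big_nil subrr.
have xb := itv_partition_le (itv_partition_cons abs).
have ax : a < x by case: abs => /= /andP[].
have xi : x \in i.
  move: ai bi; rewrite /=; case: i {IH} => l r; rewrite !itv_boundlr.
  move=> /andP[la _] /andP[_ br]; apply/andP; split.
    by rewrite (le_trans la)// bnd_simp ltW.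
  by rewrite (le_trans _ br)// bnd_simp.
have [/andP[h1 h2] [h3 h4]] := IH x xi bi (itv_partition_cons abs).
split; last split.
- rewrite /disjoint_itvs/= ai xi (ltW ax) h1 h2/= andbT.
  by apply/allP => p ps; move/allP: h3 => /(_ _ ps)/andP[-> _].
- rewrite /= lexx xb/=; apply/allP => p ps; move/allP: h3 => /(_ _ ps)/andP[xp ->].
  by rewrite andbT (le_trans (ltW ax)).
- by rewrite /= big_cons h4/=; lra.
Qed.

Lemma variation_belast (a b : R) (f : R -> R) s : itv_partition a b s ->
  variation a b f s = \sum_(p <- zip (belast a s) s) `|f p.2 - f p.1|.
Proof.
move=> abs; rewrite variation_zip//.
elim: s a {abs} => [a|x s IH a]; first by rewrite !big_nil.
by rewrite /= !big_cons/=; congr (_ + _); rewrite IH.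
Qed.

(** An interval of a family may be replaced by the pieces of a partition. *)
Lemma disjoint_itvs_split i p s L1 L2 : itv_partition p.1 p.2 s ->
  disjoint_itvs i (L2 ++ p :: L1) ->
  disjoint_itvs i ((L2 ++ zip (belast p.1 s) s) ++ L1).
Proof.
move=> ps; rewrite /disjoint_itvs !all_cat/= !pairwise_cat/=.
move=> /andP[/andP[a2 /andP[/and3P[p1i p2i _] a1]]].
rewrite allrel_consr => /and3P[/andP[r2p r21] w2 /andP[r1p w1]].
have [/andP[az wz] [pz _]] := partition_disjoint_itvs p1i p2i ps.
rewrite a1 a2 az w2 wz w1 allrel_catl r21 /= !andbT.
apply/andP; split; last first.
  apply/allrelP => x y xL2 /(allP pz)/andP[py yp].
  by move/allP: r2p => /(_ _ xL2)/orP[xp|px]; apply/orP; [left|right];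
    [exact: le_trans xp py|exact: le_trans yp px].
apply/allrelP => x y /(allP pz)/andP[py yp] yL1.
by move/allP: r1p => /(_ _ yL1)/orP[xp|px]; apply/orP; [left|right];
  [exact: le_trans yp xp|exact: le_trans px py].
Qed.

(** The modulus of absolute continuity of a function is one for its total
    variation: the total variations are replaced one after the other by
    variations along partitions. *)
Lemma sum_total_variation_le i G (e d : R) :
  (forall L, disjoint_itvs i L -> \sum_(p <- L) (p.2 - p.1) < d ->
    \sum_(p <- L) `|G p.2 - G p.1| <= e) ->
  forall L, disjoint_itvs i L -> \sum_(p <- L) (p.2 - p.1) < d ->
    (\sum_(p <- L) total_variation p.1 p.2 G <= e%:E)%E.
Proof.
move=> Gd L iL Ld.
(* L1 holds the intervals still measured by the total variation, L2 the
   pieces of those already partitioned. *)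
suff: forall L1 L2, disjoint_itvs i (L2 ++ L1) ->
    \sum_(p <- L2 ++ L1) (p.2 - p.1) < d ->
    (\sum_(p <- L1) total_variation p.1 p.2 G +
     (\sum_(p <- L2) `|G p.2 - G p.1|)%:E <= e%:E)%E.
  by move=> /(_ L [::] iL Ld); rewrite big_nil adde0.
move=> {L iL Ld}; elim => [L2|p L1 IH L2 L21 L21d].
  by rewrite cats0 big_nil add0e lee_fin; exact: Gd.
have p12 : p.1 <= p.2.
  by move: L21; rewrite /disjoint_itvs all_cat/= => /andP[/and3P[_ /and3P[]]].
have {}IH s : itv_partition p.1 p.2 s ->
    ((variation p.1 p.2 G s)%:E + (\sum_(p <- L1) total_variation p.1 p.2 G +
     (\sum_(p <- L2) `|G p.2 - G p.1|)%:E) <= e%:E)%E.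
  move=> ps; have h1 := disjoint_itvs_split ps L21.
  rewrite addeCA (le_trans _ (IH (L2 ++ zip (belast p.1 s) s) h1 _))//.
    by rewrite big_cat/= -(variation_belast G ps) -EFinD addrC.
  move: L21 L21d; rewrite /disjoint_itvs all_cat/=.
  move=> /andP[/and3P[_ /and3P[p1i p2i _] _] _].
  have [_ [_ zE]] := partition_disjoint_itvs p1i p2i ps.
  by rewrite !big_cat/= big_cons zE addrA.
move: p12; rewrite le_eqVlt => /orP[/eqP p12|p12].
  rewrite big_cons -p12 total_variationxx add0e.
  have := IH [::]; rewrite /itv_partition/= p12 eqxx variation_nil add0e.
  by apply.
set A := (\sum_(p <- L1) _ + _)%E in IH.
have L1pos : (0 <= \sum_(p <- L1) total_variation p.1 p.2 G)%E.
  rewrite big_seq; apply: sume_ge0 => q qL1; apply: total_variation_ge0.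
  move: L21; rewrite /disjoint_itvs all_cat/= => /andP[/and3P[_ _ /allP h] _].
  by move: h => /(_ _ qL1)/and3P[].
have A0 : (0 <= A)%E by rewrite adde_ge0// lee_fin sumr_ge0.
have Afin : A \is a fin_num.
  rewrite ge0_fin_numE//; apply: le_lt_trans (ltry e).
  apply: le_trans (IH [:: p.2] (itv_partition1 p12)).
  by rewrite leeDr// lee_fin; exact: variation_ge0.
rewrite big_cons -addeA -/A -leeBrDr//; apply: ge_ereal_sup => _ [_ [s ps <-] <-].
by rewrite leeBrDr//; exact: IH.
Qed.

Lemma ac_total_variation_lty (a b : R) G : a <= b -> acfun `[a, b] G ->
  (total_variation a b G < +oo)%E.
Proof.
move=> ab acG; have [d d0 /sum_total_variation_le Gd] := acG 1 ltr01.
have {}Gd x y : a <= x -> x <= y -> y <= b -> y - x < d ->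
    (total_variation x y G < +oo)%E.
  move=> ax xy yb xyd; rewrite (le_lt_trans _ (ltry 1))//.
  have := Gd [:: (x, y)]; rewrite !big_seq1/=; apply => //.
  rewrite /disjoint_itvs/= !in_itv/= ax xy (le_trans ax xy)/= yb (le_trans xy yb)//.
(* On steps of length d / 2 < d the total variation is at most 1. *)
have H n : forall x, a <= x -> x <= b -> x <= a + n%:R * (d / 2) ->
    (total_variation a x G < +oo)%E.
  elim: n => [x ax xb|n IH x ax xb xn].
    rewrite mul0r addr0 => xa.
    have -> : x = a by apply/eqP; rewrite eq_le xa ax.
    by rewrite total_variationxx ltry.
  pose y := Num.max a (x - d / 2).
  have d20 : 0 < d / 2 by rewrite divr_gt0.
  have ay : a <= y by rewrite /y le_max lexx.
  have yx : y <= x by rewrite /y ge_max ax/=; lra.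
  rewrite (total_variationD G ay yx) lte_add_pinfty//.
    apply: IH => //; first exact: le_trans yx xb.
    rewrite /y ge_max; apply/andP; split.
      by rewrite lerDl mulr_ge0// ltW.
    by move: xn; rewrite -natr1 mulrDl mul1r; lra.
  apply: Gd => //; rewrite ltrBlDr -ltrBlDl /y lt_max; apply/orP; right; lra.
apply: (H (Num.Def.truncn ((b - a) / (d / 2))).+1) => //.
rewrite -lerBlDl -ler_pdivrMr ?divr_gt0//.
exact/ltW/truncnS_gt.
Qed.

End absolute_continuity.

(** * Lebesgue-Stieltjes measures of absolutely continuous functions *)

Section stieltjes.
Variable R : realType.
Implicit Types (G H : R -> R) (L : seq (R * R)) (i : interval R).

Lemma lebesgue_stieltjes_ocitv (F : cumulative R R) (x y : R) : x <= y ->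
  lebesgue_stieltjes_measure F `]x, y]%classic = (F y - F x)%:E.
Proof.
move=> xy; rewrite /lebesgue_stieltjes_measure /measure_extension.
rewrite measurable_mu_extE; last exact: is_ocitv.
by rewrite [LHS](wlength_itv_bnd _ _ _ xy).
Qed.

(** A finite union of half-open intervals is a disjoint one, and the same
    intervals compute all its Lebesgue-Stieltjes measures. *)
Lemma fin_bigcup_ocitv (D : set (SetRing.type (ocitv_type R))) : measurable D ->
  exists2 L, disjoint_itvs `]-oo, +oo[ L &
    forall F : cumulative R R, lebesgue_stieltjes_measure F D =
      (\sum_(p <- L) (F p.2 - F p.1))%:E.
Proof.
move=> /SetRing.ring_finite_set[B [finB B0 tB mB DB]].
have /choice[h hB] : forall X : set R, exists p : R * R,
    X \in B -> p.1 < p.2 /\ X = `]p.1, p.2]%classic.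
  move=> X; have [XB|XB] := boolP (X \in B); last by exists (0, 0).
  have /ocitvP[X0|[p p12 XE]] := mB _ XB; last by exists p.
  by have /set0P := B0 _ (set_mem XB); rewrite X0 eqxx.
pose S := fset_set B.
have hS X : X \in S -> (h X).1 < (h X).2 /\ X = `](h X).1, (h X).2]%classic.
  by move=> XS; apply: hB; rewrite -(in_fset_set finB).
exists [seq h X | X <- S].
  apply/andP; split.
    by apply/allP => _ /mapP[X XS ->]; rewrite !in_itv/= ltW//; apply: (hS _ XS).1.
  rewrite pairwise_map; have uS : uniq S by exact: fset_uniq.
  have /(_ _ _)H : {in S &, forall X Y, X != Y ->
     ((h X).2 <= (h Y).1) || ((h Y).2 <= (h X).1)}.
    move=> X Y XS YS XY; apply/negP => /negP; rewrite negb_or -!ltNge => /andP[a b].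
    move/eqP : XY; apply.
    have [X12 XE] := hS _ XS; have [Y12 YE] := hS _ YS.
    apply: tB; [by apply/set_mem; rewrite -(in_fset_set finB)..|].
    move: X12 XE Y12 YE a b; move: (h X) (h Y) => p q p12 -> q12 -> qp pq.
    exists (Num.min p.2 q.2); split => /=.
      by rewrite in_itv/= lt_min p12 pq ge_min lexx.
    by rewrite in_itv/= lt_min q12 qp ge_min lexx orbT.
  have {}uS : pairwise [rel X Y | X != Y] S by rewrite -uniq_pairwise.
  apply: (sub_in_pairwise _ _ uS (P := mem S)); last exact/allP.
  by move=> X Y XS YS /= XY; exact: H.
move=> F; rewrite big_map DB -sumEFin.
rewrite measure_fin_bigcup//; last first.
  by move=> X /mem_set XB; apply: sub_sigma_algebra; exact: mB.
rewrite fsbig_finite//= big_seq [RHS]big_seq; apply: eq_bigr => X XS.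
have [+ +] := hS _ XS; move: (h X) => p p12 ->.
by rewrite lebesgue_stieltjes_ocitv ?ltW.
Qed.

Lemma ac_dominates (H : cumulative R R) : acfun `]-oo, +oo[ H ->
  lebesgue_stieltjes_measure H `<< @lebesgue_measure R.
Proof.
move=> acH; apply/null_content_dominatesP => E mE E0.
apply/eqP; rewrite eq_le measure_ge0 andbT; apply/lee_addgt0Pr => e e0.
rewrite add0e; have [d d0 Hd] := acH e e0.
(* The Lebesgue measure is by definition the outer measure of the length of
   half-open intervals, so E is covered by such intervals A of total length
   less than d; D n is the union of the first n of them. *)
have : (mu_ext (wlength (@idfun R)) E < d%:E)%E.
  by rewrite -[X in (X < _)%E]/(lebesgue_measure E) E0 lte_fin.
move=> /ereal_inf_lt[_ [A [mA EA] <-] Ad].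
pose D n : set (SetRing.type (ocitv_type R)) := \big[setU/set0]_(k < n) A k.
have rD n : measurable (D n).
  by apply: bigsetU_measurable => k _; apply: SetRing.measurable_subring.
have mD n : measurable (D n : set (measurableTypeR R)).
  by apply: bigsetU_measurable => k _; apply: sub_sigma_algebra; exact: mA.
have ED : E `<=` \bigcup_n D n.
  apply: (subset_trans EA) => x [k _ Akx]; exists k.+1 => //.
  by rewrite /D -bigcup_mkord; exists k => //=.
have mUD : measurable (\bigcup_n D n : set (measurableTypeR R)).
  exact: bigcup_measurable.
apply: (@le_trans _ _ (lebesgue_stieltjes_measure H (\bigcup_n D n))).
  by apply: le_measure => //; exact/mem_set.
have cD : lebesgue_stieltjes_measure H (D n) @[n --> \oo] -->
    lebesgue_stieltjes_measure H (\bigcup_n D n).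
  apply: nondecreasing_cvg_mu => // m n mn; apply/subsetPset.
  exact: subset_bigsetU.
rewrite -[X in (X <= _)%E](cvg_lim _ cD)//; apply: lime_le; first by apply: cvgP cD.
apply: nearW => n; have [L dL LE] := fin_bigcup_ocitv (rD n).
rewrite LE lee_fin; apply: le_trans (Hd L dL _).
  by apply: ler_sum => p _; exact: ler_norm.
rewrite -lte_fin; apply: le_lt_trans Ad.
rewrite -(LE idfun); apply: ereal_inf_lbound; exists A => //; split => //.
by move=> x; rewrite /D -bigcup_mkord => -[k _ Akx]; exists k.
Qed.

Lemma ac_nondecreasing_FTC (a b : R) H : a <= b -> {homo H : x y / x <= y} ->
  acfun `]-oo, +oo[ H ->
  exists h : R -> R, [/\ (@lebesgue_measure R).-integrable setT (EFin \o h),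
    forall x, a <= x <= b -> H x - H a = (\int[lebesgue_measure]_(t in `]a, x]) h t)%R &
    {ae (@lebesgue_measure R), forall x, a < x < b -> is_derive x 1 H (h x)}].
Proof.
move=> ab ndH acH.
pose Hc : cumulative R R := HB.pack H (isCumulative.Build R _ R H ndH
  (right_continuousW (ac_continuous acH))).
(* Restricting the Stieltjes measure to ]a, b] makes it finite. *)
have mab : measurable (`]a, b]%classic : set (measurableTypeR R)).
  exact: measurable_itv.
have fab : (lebesgue_stieltjes_measure Hc `]a, b]%classic < +oo)%E.
  by rewrite lebesgue_stieltjes_ocitv// ltry.
pose nu : {finite_measure set (measurableTypeR R) -> \bar R} := mfrestr mab fab.
have nuE A : nu A = lebesgue_stieltjes_measure Hc (A `&` `]a, b]) by [].
have dom : nu `<< @lebesgue_measure R.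
  apply/null_content_dominatesP => A mA A0; rewrite nuE.
  have /null_content_dominatesP := ac_dominates (acH : acfun _ Hc).
  apply; first exact: measurableI.
  by apply: subset_measure0 A0 => //; exact: measurableI.
have [f [f0 ff fi fE]] := radon_nikodym_sigma_finite dom.
pose h := fine \o f.
have hf : EFin \o h = f by apply/funext => x; rewrite /h/= fineK.
have hi : (@lebesgue_measure R).-integrable setT (EFin \o h) by rewrite hf.
have HE x : a <= x <= b -> H x - H a = (\int[lebesgue_measure]_(t in `]a, x]) h t)%R.
  move=> /andP[ax xb]; rewrite /Rintegral.
  have -> : (\int[lebesgue_measure]_(t in `]a, x]) (h t)%:E =
      \int[lebesgue_measure]_(t in `]a, x]) f t)%E.
    by apply: eq_integral => t _; rewrite -hf.
  rewrite -(fE `]a, x]%classic)// nuE setIidl; last first.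
    by apply: subset_itvl; rewrite bnd_simp.
  by rewrite lebesgue_stieltjes_ocitv.
exists h; split => //.
have hiy y : (@lebesgue_measure R).-integrable `]a, y] (EFin \o h).
  by apply: (integrableS measurableT _ _ hi) => //; exact: measurable_itv.
have := @FTC1 R h (BRight a) hiy.
move=> /(_ (open_integrable_locally openT hi)).
apply: filterS; first exact: (ae_filter_ringOfSetsType lebesgue_measure).
move=> x /= Hx /andP[ax xb]; have [//|dx dE] := Hx.
have xab : x \in `]a, b[ by rewrite in_itv/= ax xb.
have HF : {near x, (fun y => \int[lebesgue_measure]_(t in `]a, y]) h t + H a)%R =1 H}.
  near=> y; rewrite -HE ?subrK//.
  have : y \in `]a, b[ by near: y; exact: near_in_itvoo.
  by rewrite in_itv/= => /andP[/ltW-> /ltW->].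
apply: (near_eq_is_derive HF).
rewrite -[h x]addr0; apply: is_deriveD.
apply: DeriveDef; [exact: dx|rewrite -derive1E; exact: dE].
Unshelve. all: by end_near. Qed.

End stieltjes.

(** * The fundamental theorem of calculus for absolutely continuous functions *)

Section ftc.
Variable R : realType.
Implicit Types (G H : R -> R) (L : seq (R * R)) (i : interval R).

Lemma total_variation_fin (a b x y : R) G : a <= b -> acfun `[a, b] G ->
  a <= x -> x <= y -> y <= b -> total_variation x y G \is a fin_num.
Proof.
move=> ab acG ax xy yb; rewrite ge0_fin_numE ?total_variation_ge0//.
apply: le_lt_trans (ac_total_variation_lty ab acG).
rewrite (total_variationD G ax (le_trans xy yb)) (total_variationD G xy yb).
rewrite addeCA leeDl// adde_ge0// total_variation_ge0//.
Qed.

Lemma ac_total_variation (a b : R) G : a <= b -> acfun `[a, b] G ->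
  acfun `[a, b] (fun x => fine (total_variation a x G)).
Proof.
move=> ab acG e e0; have [d d0 Gd] := acG e e0; exists d => // L iL Ld.
rewrite -lee_fin; apply: le_trans (sum_total_variation_le Gd iL Ld).
rewrite -sumEFin big_seq [leRHS]big_seq; apply: lee_sum => p pL.
move: iL => /andP[/allP/(_ _ pL)/and3P[]]; rewrite !in_itv/=.
move=> /andP[ap pb] /andP[ap2 p2b] p12 _.
rewrite (total_variationD G ap p12) fineD; last 2 first.
- exact: (total_variation_fin ab acG).
- exact: (total_variation_fin ab acG).
rewrite [_ + fine _]addrC addrK ger0_norm ?fine_ge0 ?total_variation_ge0//.
by rewrite fineK// (total_variation_fin ab acG).
Qed.

(** An absolutely continuous function is differentiable almost everywhere, and
    it is the integral of its derivative. *)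
Lemma ac_FTC (a b : R) G : a <= b -> acfun `[a, b] G ->
  exists h : R -> R, [/\ (@lebesgue_measure R).-integrable setT (EFin \o h),
    forall x, a <= x <= b -> G x - G a = (\int[lebesgue_measure]_(t in `]a, x]) h t)%R &
    {ae (@lebesgue_measure R), forall x, a < x < b -> is_derive x 1 G (h x)}].
Proof.
move=> ab acG.
(* G = V - N with V the total variation; both are extended by constants. *)
pose V0 x := fine (total_variation a x G).
pose V := V0 \o clamp a b.
pose N x := V x - (G \o clamp a b) x.
have acV : acfun `]-oo, +oo[ V by apply/ac_clamp/ac_total_variation.
have acN : acfun `]-oo, +oo[ N by apply: acB => //; exact: ac_clamp.
have VE x y : a <= x -> x <= y -> y <= b -> V0 y = V0 x + fine (total_variation x y G).
  move=> ax xy yb; rewrite /V0 (total_variationD G ax xy) fineD//.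
  - by apply: (total_variation_fin ab acG) => //; exact: le_trans yb.
  - exact: (total_variation_fin ab acG).
have clampP x y : x <= y ->
    [/\ a <= clamp a b x, clamp a b x <= clamp a b y & clamp a b y <= b].
  move=> xy; have := clamp_itv x ab; have := clamp_itv y ab.
  by rewrite !in_itv/= => /andP[_ ->] /andP[-> _]; rewrite le_clamp.
have ndV : {homo V : x y / x <= y}.
  move=> x y /clampP[ax xy yb]; rewrite /V/= (VE _ _ ax xy yb) lerDl.
  by rewrite fine_ge0// total_variation_ge0.
have ndN : {homo N : x y / x <= y}.
  move=> x y /clampP[ax xy yb]; rewrite /N /V/= (VE _ _ ax xy yb).
  have : G (clamp a b y) - G (clamp a b x) <=
      fine (total_variation (clamp a b x) (clamp a b y) G).
    rewrite (le_trans (ler_norm _))// -lee_fin fineK.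
      exact: total_variation_ge.
    exact: (total_variation_fin ab acG).
  lra.
have [v [vi vE vd]] := ac_nondecreasing_FTC ab ndV acV.
have [m [mi mE md]] := ac_nondecreasing_FTC ab ndN acN.
have GE x : x \in `[a, b] -> V x - N x = G x.
  by move=> xab; rewrite /N/= clamp_id//; lra.
exists (v \- m); split.
- by apply: (integrableB measurableT vi mi).
- move=> x axb; rewrite -!GE ?in_itv/= ?lexx//.
  rewrite RintegralB//.
  + by rewrite -vE// -mE//; lra.
  + by apply: (integrableS measurableT _ _ vi) => //; exact: measurable_itv.
  + by apply: (integrableS measurableT _ _ mi) => //; exact: measurable_itv.
- have aef : Filter (almost_everywhere (@lebesgue_measure R)).
    exact: (ae_filter_ringOfSetsType lebesgue_measure).
  near=> x => /[dup] axb /andP[ax xb].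
  apply: (@near_eq_is_derive _ _ _ (V \- N)).
    have xab : x \in `]a, b[ by rewrite in_itv/= ax xb.
    near=> y; rewrite /= GE//; apply: subset_itv_oo_cc.
    near: y; exact: near_in_itvoo.
  apply: is_deriveB.
    by move: axb; near: x.
  by move: axb; near: x.
Unshelve. all: by end_near. Qed.

End ftc.

(** * Lower integrals and increments of curves *)

Section lower_integral.
Context d (T : measurableType d) (R : realType).
Variable mu : {measure set T -> \bar R}.
Local Open Scope ereal_scope.

(** The integral of a nonnegative function is a supremum over the simple
    functions below it, whether or not it is measurable; the lemmas of this
    section use this lower integral. *)
Lemma ge0_le_integral_nomeas (D : set T) (f g : T -> \bar R) :
  (forall x, D x -> 0 <= f x) -> (forall x, D x -> f x <= g x) ->
  \int[mu]_(x in D) f x <= \int[mu]_(x in D) g x.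
Proof.
move=> f0 fg; have g0 x : D x -> 0 <= g x by move=> Dx; rewrite (le_trans (f0 x Dx))// fg.
rewrite !ge0_integralE//; apply: ereal_sup_le => _ [h hf <-]; exists h => // x.
by rewrite (le_trans (hf x))// lee_restrict.
Qed.

Lemma ge0_subset_integral_nomeas (A B : set T) (f : T -> \bar R) :
  (forall x, B x -> 0 <= f x) -> A `<=` B ->
  \int[mu]_(x in A) f x <= \int[mu]_(x in B) f x.
Proof.
move=> f0 AB; rewrite !ge0_integralE//; last by move=> x /AB; exact: f0.
apply: ereal_sup_le => _ [h hf <-]; exists h => // x.
rewrite (le_trans (hf x))// /patch; have [/set_mem/AB/mem_set ->//|_] := boolP (x \in A).
by case: ifPn => // /set_mem/f0.
Qed.

Lemma ae_ge0_le_integral_nomeas (D : set T) (f g : T -> \bar R) : measurable D ->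
  measurable_fun D f ->
  (forall x, D x -> 0 <= f x) -> (forall x, D x -> 0 <= g x) ->
  {ae mu, forall x, D x -> f x <= g x} ->
  \int[mu]_(x in D) f x <= \int[mu]_(x in D) g x.
Proof.
move=> mD mf f0 g0 [N [mN N0 Nfg]].
rewrite (ge0_negligible_integral mN mD mf f0 N0).
apply: le_trans (ge0_subset_integral_nomeas g0 (@subDsetl _ D N)).
apply: ge0_le_integral_nomeas => x [Dx Nx]; first exact: f0.
by apply: contrapT => fgx; apply: Nx; apply: Nfg => /=; apply: contra_not fgx; apply.
Qed.

Import HBNNSimple.

Lemma ge0_integral_superadditive (A B : set T) (f : T -> \bar R) :
  [disjoint A & B] -> (forall x, (A `|` B) x -> 0 <= f x) ->
  \int[mu]_(x in A) f x + \int[mu]_(x in B) f x <= \int[mu]_(x in A `|` B) f x.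
Proof.
move=> AB f0.
have fA x : A x -> 0 <= f x by move=> Ax; apply: f0; left.
have fB x : B x -> 0 <= f x by move=> Bx; apply: f0; right.
have IA := integral_ge0 mu fA; have IB := integral_ge0 mu fB.
have [->|AB_fin] := eqVneq (\int[mu]_(x in A `|` B) f x) +oo; first by rewrite leey.
have {}AB_fin : \int[mu]_(x in A `|` B) f x \is a fin_num.
  by rewrite ge0_fin_numE ?integral_ge0// ltey.
have B_fin : \int[mu]_(x in B) f x \is a fin_num.
  rewrite ge0_fin_numE// (le_lt_trans (ge0_subset_integral_nomeas f0 (@subsetUr _ A B)))//.
  by rewrite ltey_eq AB_fin.
rewrite -leeBrDr// {1}ge0_integralE//; apply: ge_ereal_sup => _ [h hf <-].
have h_fin : sintegral mu h \is a fin_num.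
  rewrite ge0_fin_numE ?sintegral_ge0//.
  apply: le_lt_trans (_ : \int[mu]_(x in A `|` B) f x < +oo); last by rewrite ltey_eq AB_fin.
  apply: le_trans (ge0_subset_integral_nomeas f0 (@subsetUl _ A B)).
  by rewrite ge0_integralE//; apply: ereal_sup_ubound; exists h.
rewrite leeBrDr// addeC -leeBrDr// {1}ge0_integralE//.
apply: ge_ereal_sup => _ [k kf <-]; rewrite leeBrDr// addeC.
rewrite -sintegralD// ge0_integralE//; apply: ereal_sup_ubound.
exists (add_nnsfun h k) => // x /=.
have := hf x; have := kf x; rewrite /patch in_setU EFinD.
have [xA|xA] := boolP (x \in A); have [xB|xB] := boolP (x \in B) => //=.
- have : (A `&` B) x by split; exact: set_mem.
  by move/disj_set2P : AB => ->.
- by move=> k0 hx; rewrite -[leRHS]adde0 leeD.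
- by move=> kx h0; rewrite -[leRHS]add0e leeD.
- by move=> k0 h0; rewrite -[leRHS]add0e leeD.
Qed.

End lower_integral.

Section curve.
Variable (R : realType) (n : nat).
Implicit Types (F : R -> 'rV[R]_n) (b : 'I_n -> R).

Lemma coord_le_eucl_norm (v : 'rV[R]_n) k : `|v ord0 k| <= eucl_norm v.
Proof.
rewrite -sqrtr_sqr /eucl_norm ler_wsqrtr// (bigD1 k)//= lerDl.
by apply: sumr_ge0 => j _; exact: sqr_ge0.
Qed.

Lemma eucl_norm_ge0 (v : 'rV[R]_n) : 0 <= eucl_norm v.
Proof. exact: sqrtr_ge0. Qed.

Lemma abs_continuous_functional (s t : R) F b : abs_continuous s t F ->
  acfun `[s, t] (fun u => \sum_k b k * F u ord0 k).
Proof.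
move=> acF e e0; pose C := \sum_k `|b k|.
have C0 : 0 <= C by exact: sumr_ge0.
have [d d0 Fd] := acF (e / (C + 1)) (divr_gt0 e0 (ltr_wpDl C0 ltr01)).
exists d => // L /andP[/allP iL pL] Ld.
pose p0 : R * R := (0, 0).
have := Fd (size L) (fun k => (nth p0 L k).1) (fun k => (nth p0 L k).2).
rewrite -(big_mkord xpredT (fun k => (nth p0 L k).2 - (nth p0 L k).1)).
rewrite -(big_mkord xpredT (fun k => eucl_norm (F (nth p0 L k).2 - F (nth p0 L k).1))).
rewrite -(big_nth p0 xpredT (fun p => p.2 - p.1)).
rewrite -(big_nth p0 xpredT (fun p => eucl_norm (F p.2 - F p.1))) => {}Fd.
have {}Fd : \sum_(p <- L) eucl_norm (F p.2 - F p.1) < e / (C + 1).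
  apply: Fd => //.
    move=> k; have := iL _ (mem_nth p0 (ltn_ord k)); rewrite !in_itv/=.
    by move=> /and3P[/andP[-> _] /andP[_ ->] ->].
  have H (k l : 'I_(size L)) : (k < l)%N ->
      `](nth p0 L k).1, (nth p0 L k).2[%classic `&`
      `](nth p0 L l).1, (nth p0 L l).2[%classic = set0.
    move=> kl; apply/seteqP; split => // x /= [].
    rewrite !in_itv/= => /andP[k1 k2] /andP[l1 l2].
    have /(pairwiseP p0)/(_ k l (ltn_ord k) (ltn_ord l) kl)/orP[] := pL.
      by move=> /(lt_le_trans k2)/lt_trans/(_ l1); rewrite ltxx.
    by move=> /(lt_le_trans l2)/lt_trans/(_ k1); rewrite ltxx.
  apply/trivIsetP => k l _ _; rewrite -val_eqE neq_ltn => /orP[|]; first exact: H.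
  by rewrite setIC; exact: H.
apply: (@le_trans _ _ (\sum_(p <- L) C * eucl_norm (F p.2 - F p.1))).
  apply: ler_sum => p _; rewrite -sumrB mulr_suml.
  apply: le_trans (ler_norm_sum _ _ _) _; apply: ler_sum => k _.
  rewrite -mulrBr normrM ler_wpM2l//.
  by apply: le_trans (coord_le_eucl_norm _ k); rewrite !mxE.
rewrite -mulr_sumr; apply: le_trans (ler_wpM2l C0 (ltW Fd)) _.
rewrite mulrA ler_pdivrMr ?ltr_wpDl// mulrC ler_wpM2l ?(ltW e0)//; lra.
Qed.

Lemma is_derive_functional F b (u : R) v : is_derive u 1 F v ->
  is_derive u 1 (fun u => \sum_k b k * F u ord0 k) (\sum_k b k * v ord0 k).
Proof.
move=> dF; have dk k : is_derive u 1 (fun u => F u ord0 k) (v ord0 k).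
  have dFu : derivable F u 1 by [].
  apply: DeriveDef; first exact: ((derivable_mxP _ _ _).1 dFu).
  by rewrite -(@derive_val _ _ _ _ _ _ _ dF) (derive_mx dFu) mxE.
have -> : (fun u => \sum_k b k * F u ord0 k) =
    \sum_k (b k \*: (fun u => F u ord0 k : R^o)).
  by apply/funext => x; rewrite fct_sumE.
by apply: is_derive_sum => k; exact: is_deriveZ.
Qed.

Lemma derivable_rV F (u : R) : (forall k, derivable (fun u => F u ord0 k) u 1) ->
  derivable F u 1.
Proof. by move=> dk; apply/derivable_mxP => i j; rewrite (ord1 i); exact: dk. Qed.

(** If a linear functional of the velocity of an absolutely continuous curve is
    at most [phi], its increment is at most the lower integral of [phi]; [phi]
    need not be measurable. *)
Lemma abs_continuous_functional_le (s t : R) F b (phi : R -> \bar R) :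
  s <= t -> abs_continuous s t F -> (forall u, (0 <= phi u)%E) ->
  (forall u v, s < u < t -> is_derive u 1 F v ->
     ((\sum_k b k * v ord0 k)%:E <= phi u)%E) ->
  ((\sum_k b k * (F t - F s) ord0 k)%:E <=
     \int[lebesgue_measure]_(u in `]s, t]) phi u)%E.
Proof.
move=> st acF phi0 Fphi.
have [h [hi hE hd]] := ac_FTC st (abs_continuous_functional b acF).
have mst : measurable (`]s, t]%classic : set (measurableTypeR R)).
  exact: measurable_itv.
have his : (@lebesgue_measure R).-integrable `]s, t] (EFin \o h).
  by apply: (integrableS measurableT _ _ hi).
have -> : \sum_k b k * (F t - F s) ord0 k =
    (\int[lebesgue_measure]_(u in `]s, t]) h u)%R.
  rewrite -hE ?st ?lexx// -sumrB; apply: eq_bigr => k _.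
  by rewrite !mxE mulrBr.
rewrite /Rintegral fineK; last exact: integrable_fin_num.
(* The positive part of the density h is measurable and, almost everywhere, at
   most phi. *)
apply: (@le_trans _ _ (\int[lebesgue_measure]_(u in `]s, t]) ((EFin \o h)^\+ u))%E).
  apply: (le_integral mst his (integrable_funepos mst his)).
  by move=> u _; rewrite funeposE le_max lexx.
apply: ae_ge0_le_integral_nomeas => //.
- exact: (measurable_funepos (measurable_int _ his)).
- have aef : Filter (almost_everywhere (@lebesgue_measure R)).
    exact: (ae_filter_ringOfSetsType lebesgue_measure).
  have dk k : {ae (@lebesgue_measure R), forall x, s < x < t ->
      derivable (fun u => F u ord0 k) x 1}.
    have [hk [_ _]] := ac_FTC st
      (abs_continuous_functional (fun j => (j == k)%:R) acF).
    apply: filterS => x H /H; rewrite (_ : (fun u => _) = fun u => F u ord0 k)//.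
      apply/funext => u; rewrite (bigD1 k)//= eqxx mul1r big1 ?addr0// => j jk.
      by rewrite (negbTE jk) mul0r.
  have nt : {ae (@lebesgue_measure R), forall x, x != t}.
    exists [set t]; split => //; first exact: lebesgue_measure_set1.
    by move=> x /= /negP; rewrite negbK => /eqP.
  have {}dk := filter_forall aef dk.
  near=> u => /=; rewrite in_itv/= => /andP[su ut].
  have {}ut : u < t by rewrite lt_neqAle ut andbT; near: u.
  have sut : s < u < t by rewrite su ut.
  have Fu : derivable F u 1.
    apply: derivable_rV => k; move: k sut; near: u.
    by apply: filterS dk => x H k; exact: H.
  have dF : is_derive u 1 F ('D_1 F u) by exact: DeriveDef.
  have hu : h u = \sum_k b k * ('D_1 F u) ord0 k.
    have h1 := is_derive_functional b dF.
    have h2 : is_derive u 1 (fun u => \sum_k b k * F u ord0 k) (h u).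
      by move: sut; near: u.
    by rewrite -(@derive_val _ _ _ _ _ _ _ h2) (@derive_val _ _ _ _ _ _ _ h1).
  by rewrite funeposE ge_max phi0 andbT /= hu; exact: Fphi.
Unshelve. all: by end_near. Qed.

End curve.

(** * Quadratic forms, the Euclidean norm and a covering lemma *)

Section forms.
Variables (R : realType) (n : nat).
Implicit Types (A : 'M[R]_n) (v w : 'rV[R]_n).

(** The bilinear form with matrix [A], on row vectors. *)
Definition bform A v w : R := (v *m A *m w^T) ord0 ord0.

(** Symmetric positive semidefinite matrices. *)
Definition psd A := A^T = A /\ forall v, 0 <= bform A v v.

(** The seminorm attached to [A]. *)
Definition anorm A v := Num.sqrt (bform A v v).

Lemma bformE A v w : bform A v w = \sum_a \sum_b v ord0 a * w ord0 b * A a b.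
Proof.
rewrite /bform mxE exchange_big/=; apply: eq_bigr => b _.
rewrite !mxE mulr_suml; apply: eq_bigr => a _; ring.
Qed.

Lemma bformDl A v v' w : bform A (v + v') w = bform A v w + bform A v' w.
Proof. by rewrite /bform !mulmxDl mxE. Qed.

Lemma bformZl A k v w : bform A (k *: v) w = k * bform A v w.
Proof. by rewrite /bform -!scalemxAl mxE. Qed.

Lemma bformC A v w : A^T = A -> bform A v w = bform A w v.
Proof.
move=> AT; rewrite /bform.
have -> : v *m A *m w^T = (w *m A *m v^T)^T by rewrite !trmx_mul trmxK AT mulmxA.
by rewrite mxE.
Qed.

Lemma bformDr A v w w' : bform A v (w + w') = bform A v w + bform A v w'.
Proof. by rewrite /bform linearD/= mulmxDr mxE. Qed.

Lemma bformZr A k v w : bform A v (k *: w) = k * bform A v w.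
Proof. by rewrite /bform linearZ/= -scalemxAr mxE. Qed.

Lemma bform_functional A v w :
  bform A v w = \sum_k (A *m w^T) k ord0 * v ord0 k.
Proof. by rewrite /bform -mulmxA mxE; apply: eq_bigr => k _; rewrite mulrC. Qed.

(** The Cauchy-Schwarz inequality for semidefinite forms. *)
Lemma bform_CS A v w : psd A -> bform A v w ^+ 2 <= bform A v v * bform A w w.
Proof.
move=> [AT A0]; have [c0|c0] := eqVneq (bform A w w) 0.
  suff -> : bform A v w = 0 by rewrite c0 expr0n/= mulr0.
  apply/eqP; apply: contraT => b0.
  (* This t gives v + t w the value -1. *)
  pose t := - (bform A v v + 1) / (2 * bform A v w).
  have := A0 (v + t *: w).
  rewrite !(bformDl, bformDr, bformZl, bformZr) (bformC w v AT) c0 !mulr0 addr0.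
  rewrite /t; have -> : bform A v v + - (bform A v v + 1) / (2 * bform A v w) * bform A v w +
    - (bform A v v + 1) / (2 * bform A v w) * bform A v w = -1 by field.
  by rewrite ler0N1.
have {}c0 : 0 < bform A w w by rewrite lt_neqAle eq_sym c0 A0.
have := A0 (bform A w w *: v + (- bform A v w) *: w).
rewrite !(bformDl, bformDr, bformZl, bformZr) (bformC w v AT).
set a := bform A v v; set b := bform A v w; set c := bform A w w in c0 *.
move=> H; rewrite -subr_ge0 -(pmulr_rge0 _ c0); apply: le_trans H _.
by rewrite le_eqVlt; apply/orP; left; apply/eqP; ring.
Qed.

Lemma anorm_ge0 A v : 0 <= anorm A v. Proof. exact: sqrtr_ge0. Qed.

Lemma sqr_anorm A v : psd A -> anorm A v ^+ 2 = bform A v v.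
Proof. by move=> [_ A0]; rewrite sqr_sqrtr. Qed.

Lemma bform_le_anorm A v w : psd A -> bform A v w <= anorm A v * anorm A w.
Proof.
move=> pA; apply: le_trans (ler_norm _) _.
rewrite -sqrtr_sqr /anorm -sqrtrM; last by case: pA.
by rewrite ler_wsqrtr// bform_CS.
Qed.

Lemma ler_anormD A v w : psd A -> anorm A (v + w) <= anorm A v + anorm A w.
Proof.
move=> pA; have [AT A0] := pA.
have vw0 : 0 <= anorm A v + anorm A w by rewrite addr_ge0// anorm_ge0.
rewrite -(ger0_norm vw0) -sqrtr_sqr ler_wsqrtr//.
rewrite !(bformDl, bformDr) (bformC w v AT) sqrrD !sqr_anorm//.
have := bform_le_anorm v w pA; lra.
Qed.

Lemma anormZ A k v : anorm A (k *: v) = `|k| * anorm A v.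
Proof. by rewrite /anorm bformZl bformZr mulrA -expr2 sqrtrM ?sqr_ge0// sqrtr_sqr. Qed.

Lemma anorm0 A : anorm A 0 = 0.
Proof. by rewrite -(scale0r (0 : 'rV[R]_n)) anormZ normr0 mul0r. Qed.

Lemma bform_diag_continuous A : continuous (fun v => bform A v v).
Proof.
have -> : (fun v => bform A v v) =
    (fun v => \sum_a \sum_b v ord0 a * v ord0 b * A a b).
  by apply/funext => v; exact: bformE.
move=> v; have H a b : (fun x : 'rV[R]_n => x ord0 a * x ord0 b * A a b) @ v -->
    (v ord0 a * v ord0 b * A a b : R).
  have c k := @matrix_normedtype.coord_continuous R 1 n ord0 k v.
  exact: (cvgM (cvgM (c a) (c b)) (cvg_cst (A a b))).
apply: cvg_big; [exact: add_continuous|exact: nbhs_filter|move=> a _].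
by apply: cvg_big; [exact: add_continuous|exact: nbhs_filter|move=> b _; exact: H].
Qed.

Lemma anorm_continuous A : continuous (anorm A).
Proof.
move=> v; apply: (@continuous_comp _ _ _ (fun v => bform A v v) Num.sqrt).
  exact: bform_diag_continuous.
exact: sqrt_continuous.
Qed.

Lemma bform1 v : bform 1%:M v v = \sum_k v ord0 k ^+ 2.
Proof. by rewrite /bform mulmx1 mxE; apply: eq_bigr => k _; rewrite mxE -expr2. Qed.

Lemma psd1 : psd 1%:M.
Proof.
split; first exact: trmx1.
by move=> v; rewrite bform1; apply: sumr_ge0 => k _; exact: sqr_ge0.
Qed.

Lemma eucl_normE v : eucl_norm v = anorm 1%:M v.
Proof. by rewrite /anorm bform1. Qed.

Lemma ler_eucl_normD v w : eucl_norm (v + w) <= eucl_norm v + eucl_norm w.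
Proof. by rewrite !eucl_normE; exact: ler_anormD psd1. Qed.

Lemma eucl_normZ k v : eucl_norm (k *: v) = `|k| * eucl_norm v.
Proof. by rewrite !eucl_normE anormZ. Qed.

Lemma eucl_norm_continuous : continuous (@eucl_norm R n).
Proof.
have -> : @eucl_norm R n = anorm 1%:M by apply/funext => v; exact: eucl_normE.
exact: anorm_continuous.
Qed.

Lemma eucl_dist_continuous x : continuous (fun y : 'rV[R]_n => eucl_norm (y - x)).
Proof.
move=> y; apply: (@continuous_comp _ _ _ (fun y : 'rV[R]_n => y - x) (@eucl_norm R n)).
  exact: (cvgB cvg_id (cvg_cst x)).
exact: eucl_norm_continuous.
Qed.

Lemma closed_eucl_ball x (r : R) : closed [set y : 'rV[R]_n | eucl_norm (y - x) <= r].
Proof.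
have -> : [set y : 'rV[R]_n | eucl_norm (y - x) <= r] =
    (fun y => eucl_norm (y - x)) @^-1` [set z | z <= r] by [].
apply: closed_comp; last exact: closed_le.
by move=> y _; exact: eucl_dist_continuous.
Qed.

Lemma compact_eucl_ball x (r : R) : compact [set y : 'rV[R]_n | eucl_norm (y - x) <= r].
Proof.
apply: bounded_closed_compact; last exact: closed_eucl_ball.
exists (`|x| + `|r|); split; first exact: num_real.
move=> B rB y /= yr; apply: le_trans (ltW rB).
rewrite -[y](subrK x) addrC; apply: le_trans (ler_normD _ _) _.
rewrite lerD2l /Num.Def.normr/= mx_normrE; apply: bigmax_le => [|-[i k] _ /=].
  exact: normr_ge0.
rewrite (ord1 i); apply: le_trans (coord_le_eucl_norm _ k) _.
exact: le_trans yr (ler_norm _).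
Qed.

End forms.

Section covering.
Variables (R : realType) (q n : nat).

(** Let [A] be definite and [k > L]. If, on the closed ball of center [x] and
    radius [k |w - F x|_A], the differentials of [F] are onto, every [d] having a
    preimage of Euclidean norm at most [L |d|_A], then [F] takes the value [w]
    in this ball. *)
Lemma local_covering (A : 'M[R]_n) (F : 'rV[R]_q -> 'rV[R]_n) (x : 'rV[R]_q)
    (w : 'rV[R]_n) (L k : R) : psd A -> (forall v, bform A v v = 0 -> v = 0) ->
  0 <= L -> L < k ->
  (forall y, eucl_norm (y - x) <= k * anorm A (w - F x) ->
    differentiable F y /\
    forall d, exists2 h, 'd F y h = d & eucl_norm h <= L * anorm A d) ->
  exists2 z, F z = w & eucl_norm (z - x) <= k * anorm A (w - F x).
Proof.
move=> pA A0 L0 Lk HF; set r := k * anorm A (w - F x).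
have k0 : 0 < k by exact: le_lt_trans Lk.
have r0 : 0 <= r by rewrite mulr_ge0 ?anorm_ge0 ?ltW.
pose K := [set y : 'rV[R]_q | eucl_norm (y - x) <= r].
have Kx : K x.
  by rewrite /K/= subrr eucl_normE anorm0.
pose psi y := anorm A (w - F y) + eucl_norm (y - x) / k.
have psic : {within K, continuous psi}.
  apply: continuous_in_subspaceT => y /set_mem Ky.
  have cF : F @ y --> F y by apply: differentiable_continuous; have [] := HF y Ky.
  have c1 : (fun y => anorm A (w - F y)) @ y --> anorm A (w - F y).
    apply: (cvg_comp (fun y => w - F y) (anorm A)); last exact: anorm_continuous.
    exact: (cvgB (cvg_cst w) cF).
  exact: (cvgD c1 (cvgM (@eucl_dist_continuous R q x y) (cvg_cst k^-1))).
(* At a minimiser z of psi, the value w must be reached. *)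
have [z /set_mem Kz zmin] :=
  EVT_min_rV (ex_intro _ x Kx) (@compact_eucl_ball R q x r) psic.
have zx : psi z <= anorm A (w - F x).
  apply: le_trans (zmin x (mem_set Kx)) _.
  by rewrite /psi subrr (eucl_normE 0) anorm0 mul0r addr0.
exists z => //; set d := w - F z.
have [Nd|Nd] := eqVneq (anorm A d) 0.
  have /A0 : bform A d d = 0 by rewrite -sqr_anorm// Nd expr0n.
  by move/eqP; rewrite subr_eq0 => /eqP.
exfalso; have {}Nd : 0 < anorm A d by rewrite lt_neqAle eq_sym Nd anorm_ge0.
have [dFz /(_ d)[h hd hL]] := HF z Kz.
(* Moving from z by t h decreases |w - F| by t |d| up to an error less than
   t e, and increases |- x| / k by at most t L |d| / k: psi decreases. *)
pose e := anorm A d * (1 - L / k).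
have e0 : 0 < e by rewrite mulr_gt0// subr_gt0 ltr_pdivrMr// mul1r.
have zr : eucl_norm (z - x) < r.
  move: zx; rewrite /psi -/d /r => zx.
  rewrite mulrC -ltr_pdivrMr//; apply: lt_le_trans zx; lra.
have dcvg : (fun t : R => anorm A (d - t^-1 *: (F (t *: h + z) - F z))) @ 0^' --> (0 : R).
  have dz : derivable F z h by exact: diff_derivable.
  have dcv : (fun t : R => t^-1 *: (F (t *: h + z) - F z)) @ 0^' --> 'D_h F z.
    exact: dz.
  rewrite deriveE// hd in dcv.
  have H := cvg_comp _ _ (cvgB (cvg_cst d) dcv) (@anorm_continuous R n A (d - d)).
  rewrite subrr anorm0 in H; exact: H.
have near1 : \forall t \near (0 : R)^'+, anorm A (d - t^-1 *: (F (t *: h + z) - F z)) < e.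
  have H := (@cvgrPdist_lt _ R^o _ _ _ _ _).1 (cvg_dnbhs_at_right dcvg) e e0.
  near=> t; rewrite -(ger0_norm (anorm_ge0 _ _)) -normrN -sub0r; near: t.
  exact: H.
have near2 : \forall t \near (0 : R)^'+, eucl_norm (t *: h + z - x) < r.
  have c1 : (fun t : R => t *: h + z) @ (0 : R) --> 0 *: h + z.
    exact: (cvgD (cvgZr_tmp cvg_id) (cvg_cst z)).
  have H := cvg_comp _ _ c1 (@eucl_dist_continuous R q x _).
  rewrite scale0r add0r in H.
  have {}H : (fun t : R => eucl_norm (t *: h + z - x)) @ 0^'+ --> eucl_norm (z - x).
    by apply: cvg_at_right_filter; exact: H.
  exact: (@cvgr_lt _ _ _ _ _ _ H r zr).
have : \forall t \near (0 : R)^'+, False.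
  near=> t.
  have t0 : 0 < t by near: t; exact: nbhs_right_gt.
  have t1 : t < 1 by near: t; exact: nbhs_right_lt.
  have Kt : K (t *: h + z) by apply: ltW; near: t.
  have := zmin _ (mem_set Kt); rewrite /psi -/d.
  set z' := t *: h + z; apply/negP; rewrite -ltNge.
  have N1 : anorm A (w - F z') < (1 - t) * anorm A d + t * e.
    have -> : w - F z' = (1 - t) *: d + t *: (d - t^-1 *: (F z' - F z)).
      rewrite [X in _ = _ + X]scalerBr scalerA divff ?gt_eqF// scale1r scalerBl scale1r.
      by rewrite addrA subrK /d opprB addrA subrK.
    apply: le_lt_trans (ler_anormD _ _ pA) _.
    rewrite !anormZ !gtr0_norm ?subr_gt0// ltrD2l ltr_pM2l// /z'; near: t.
    exact: near1.
  have N2 : eucl_norm (z' - x) / k <= eucl_norm (z - x) / k + t * (L * anorm A d) / k.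
    rewrite -mulrDl ler_pM2r ?invr_gt0//.
    have -> : z' - x = (z - x) + t *: h by rewrite /z' -addrA addrC.
    apply: le_trans (ler_eucl_normD _ _) _; rewrite lerD2l eucl_normZ gtr0_norm//.
    by rewrite ler_pM2l.
  apply: lt_le_trans (ltr_leD N1 N2) _.
  rewrite le_eqVlt; apply/orP; left; apply/eqP; rewrite /e; field.
  by rewrite gt_eqF.
by move=> /filter_ex[].
Unshelve. all: by end_near. Qed.

End covering.

(** * The metric in a chart *)

Section charts.
Variables (R : realType) (n : nat) (M : manifold R n).
Implicit Types (i j k : index M) (p : M) (v w : 'rV[R]_n).

Lemma near_chart_image i p : dom i p ->
  \forall y \near coord i p, (coord i @` dom i) y.
Proof. by move=> ip; apply: open_nbhs_nbhs; split; [exact: coord_open|exists p]. Qed.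

Lemma near_chart_dom i j p : dom i p -> dom j p ->
  \forall y \near coord i p, dom j (param i y).
Proof.
move=> ip jp; have ci : (coord i @` dom i) (coord i p) by exists p.
apply: (param_continuous ci); rewrite coordK//.
by apply: open_nbhs_nbhs; split => //; exact: dom_open.
Qed.

Lemma transition_differentiable i j p : dom i p -> dom j p ->
  differentiable (coord j \o param i) (coord i p).
Proof. by move=> ip jp; apply: (transition_C2 i j).1; exists p. Qed.

(** The cocycle relation of the differentials of the transition maps. *)
Lemma transition_comp i j k p v : dom i p -> dom j p -> dom k p ->
  'd (coord k \o param j) (coord j p) ('d (coord j \o param i) (coord i p) v) =
  'd (coord k \o param i) (coord i p) v.
Proof.
move=> ip jp kp.
have dij := transition_differentiable ip jp.
have djk := transition_differentiable jp kp.
have E : (coord j \o param i) (coord i p) = coord j p by rewrite /= coordK.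
rewrite -E in djk *.
transitivity ('d ((coord k \o param j) \o (coord j \o param i)) (coord i p) v).
  exact: (congr1 (fun h => h v) (esym (diff_comp dij djk))).
apply: etrans (esym (deriveE v (differentiable_comp dij djk))) _.
apply: etrans _ (deriveE v (transition_differentiable ip kp)).
apply: near_eq_derive; have := near_chart_dom ip jp; apply: filterS => y jy /=.
by rewrite coordK.
Qed.

Lemma transition_id i p v : dom i p -> 'd (coord i \o param i) (coord i p) v = v.
Proof.
move=> ip; apply: etrans (esym (deriveE v (transition_differentiable ip ip))) _.
rewrite -[RHS](@derive_id R _ (coord i p) v); apply: near_eq_derive.
have := near_chart_image ip; apply: filterS => _ [r ir <-] /=.
by rewrite coordK.
Qed.

Lemma chart_vectorE i j p v : dom j p ->
  chart_vector i p v j = 'd (coord j \o param i) (coord i p) v.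
Proof. by move=> jp; rewrite /chart_vector /family_at mem_set. Qed.

Lemma chart_vector_out i j p v : ~ dom j p -> chart_vector i p v j = 0.
Proof. by move=> jp; rewrite /chart_vector /family_at memNset. Qed.

Lemma chart_vector_tangent i p v : dom i p -> tangent_space p (chart_vector i p v).
Proof.
move=> ip; split => [j k jp kp|j]; last exact: chart_vector_out.
rewrite (chart_vectorE i v jp) (chart_vectorE i v kp).
exact: (esym (transition_comp v ip jp kp)).
Qed.

Lemma chart_vector_linear i p (a : R) v w : dom i p ->
  chart_vector i p (a *: v + w) =
  (fun j => a *: chart_vector i p v j + chart_vector i p w j).
Proof.
move=> ip; apply/funext => j; have [jp|jp] := pselect (dom j p).
  rewrite (chart_vectorE i _ jp) (chart_vectorE i v jp) (chart_vectorE i w jp).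
  exact: linearP.
by rewrite !chart_vector_out// scaler0 addr0.
Qed.

Variable g : riemannian_metric M.

(** The matrix of the metric at [p] in the coordinates of the chart [i];
    meaningful when [p] lies in that chart. *)
Definition gram i p : 'M[R]_n := \matrix_(a, b)
  g p (chart_vector i p (delta_mx 0 a)) (chart_vector i p (delta_mx 0 b)).

(* The metric as a bilinear form on components in the chart i. *)
Let G i p v w := g p (chart_vector i p v) (chart_vector i p w).

Let GP i p a v v' w : dom i p -> G i p (a *: v + v') w = a * G i p v w + G i p v' w.
Proof.
move=> ip; rewrite /G chart_vector_linear// inner_linear//; exact: chart_vector_tangent.
Qed.

Let GC i p v w : dom i p -> G i p v w = G i p w v.
Proof. by move=> ip; apply: inner_sym; exact: chart_vector_tangent. Qed.

Let G0 i p w : dom i p -> G i p 0 w = 0.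
Proof. by move=> ip; have := GP 1 0 0 w ip; rewrite scaler0 addr0 mul1r => ?; lra. Qed.

Let Gsum i p v w : dom i p ->
  G i p v w = \sum_a v ord0 a * G i p (delta_mx 0 a) w.
Proof.
move=> ip; rewrite {1}(row_sum_delta v).
elim/big_rec2: _ => [|a x y _ IH]; first exact: G0.
by rewrite GP// IH.
Qed.

Lemma inner_chart_vector i p v w : dom i p ->
  g p (chart_vector i p v) (chart_vector i p w) = bform (gram i p) v w.
Proof.
move=> ip; rewrite bformE -[LHS]/(G i p v w) Gsum//; apply: eq_bigr => a _.
rewrite GC// Gsum// mulr_sumr; apply: eq_bigr => b _.
by rewrite mulrA GC// mxE.
Qed.

Lemma gram_psd i p : dom i p -> psd (gram i p).
Proof.
move=> ip; split.
  by apply/matrixP => a b; rewrite !mxE; exact: GC.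
move=> v; rewrite -inner_chart_vector//; have [->|v0] := eqVneq v 0.
  by rewrite -[X in _ <= X]/(G i p 0 0) G0.
apply/ltW/inner_pos; first exact: chart_vector_tangent.
by exists i; rewrite (chart_vectorE i v ip) (transition_id v ip); exact/eqP.
Qed.

Lemma gram_definite i p v : dom i p -> bform (gram i p) v v = 0 -> v = 0.
Proof.
move=> ip; rewrite -inner_chart_vector// => v0; apply/eqP; apply: contraT => vn0.
have : 0 < g p (chart_vector i p v) (chart_vector i p v).
  apply: inner_pos; first exact: chart_vector_tangent.
  by exists i; rewrite (chart_vectorE i v ip) (transition_id v ip); exact/eqP.
by rewrite v0 ltxx.
Qed.

Lemma gram_continuous i p a b : dom i p ->
  {for coord i p, continuous (fun y => gram i (param i y) a b : R)}.
Proof.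
move=> ip; have [+ _] := inner_C1 g i (delta_mx 0 a) (delta_mx 0 b).
move=> /(_ (coord i p)) H; have {}H := H (ex_intro2 _ _ p ip erefl).
have -> : (fun y => gram i (param i y) a b) = (fun x => g (param i x)
  (chart_vector i (param i x) (delta_mx 0 a))
  (chart_vector i (param i x) (delta_mx 0 b))).
  by apply/funext => y; rewrite mxE.
exact: (differentiable_continuous H).
Qed.

(** A definite form dominates the square of the Euclidean norm, by compactness
    of the unit sphere. *)
Lemma unit_sphere_bound (A : 'M[R]_n) : psd A -> (forall v, bform A v v = 0 -> v = 0) ->
  exists2 m : R, 0 < m & forall v, m * eucl_norm v ^+ 2 <= bform A v v.
Proof.
move=> pA A0; pose S := [set v : 'rV[R]_n | eucl_norm v = 1].
have [S0|/nonemptyPn S0] := pselect (S !=set0); last first.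
  exists 1 => // v; suff -> : v = 0.
    by rewrite (eucl_normE 0) anorm0 expr0n mulr0; case: pA.
  apply: contrapT => /eqP v0; have : S ((eucl_norm v)^-1 *: v); last by rewrite S0.
  have ev : eucl_norm v != 0.
    apply: contra v0 => /eqP ev; apply/eqP/rowP => k; rewrite mxE.
    apply/eqP; rewrite -normr_eq0 eq_le normr_ge0 andbT -ev.
    exact: coord_le_eucl_norm.
  rewrite /S/= eucl_normZ ger0_norm ?invr_ge0 ?eucl_norm_ge0//.
  by rewrite mulVf.
have cS : compact S.
  apply: (subclosed_compact _ (@compact_eucl_ball R n 0 1)); last first.
    by move=> v /=; rewrite subr0 => ->.
  have -> : S = (@eucl_norm R n) @^-1` [set z | z = 1] by [].
  apply: closed_comp; last exact: closed_eq.
  by move=> y _; exact: eucl_norm_continuous.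
have [z /set_mem Sz zmin] := EVT_min_rV S0 cS
  (continuous_subspaceT (@bform_diag_continuous R n A)).
have m0 : 0 < bform A z z.
  rewrite lt_neqAle eq_sym pA.2 andbT; apply/eqP => /A0 z0.
  move: Sz; rewrite /S/= z0 eucl_normE anorm0 => /esym/eqP; rewrite oner_eq0.
  by [].
exists (bform A z z) => // v.
have [ev|ev] := eqVneq (eucl_norm v) 0.
  by rewrite ev expr0n mulr0; case: pA.
have evp : 0 < eucl_norm v by rewrite lt_neqAle eq_sym ev eucl_norm_ge0.
have /mem_set/zmin : S ((eucl_norm v)^-1 *: v).
  by rewrite /S/= eucl_normZ gtr0_norm ?invr_gt0// mulVf.
rewrite bformZl bformZr mulrA -expr2 exprVn mulrC ler_pdivlMr ?exprn_gt0//.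
Qed.

Lemma bform_dist_le (A B : 'M[R]_n) v : `|bform A v v - bform B v v| <=
  (\sum_a \sum_b `|A a b - B a b|) * eucl_norm v ^+ 2.
Proof.
rewrite (bformE A) (bformE B) -sumrB; apply: le_trans (ler_norm_sum _ _ _) _.
rewrite mulr_suml; apply: ler_sum => a _.
rewrite -sumrB; apply: le_trans (ler_norm_sum _ _ _) _.
rewrite mulr_suml; apply: ler_sum => b _.
rewrite -mulrBr normrM mulrC ler_wpM2l// normrM expr2.
by apply: ler_pM => //; exact: coord_le_eucl_norm.
Qed.

(** Two quantities differing by at most a quarter of the first are within a
    factor 25/16, the square of 5/4, of each other. *)
Lemma quarter_close (a b : R) : 0 <= a -> `|b - a| <= 4^-1 * a ->
  b <= 25/16 * a /\ a <= 25/16 * b.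
Proof. by rewrite ler_norml => a0 /andP[h1 h2]; split; lra. Qed.

(** Near a point the metric is within a factor 5/4 of its value there. *)
Lemma near_gram_le i p : dom i p -> \forall y \near coord i p, forall v,
  anorm (gram i (param i y)) v <= 5/4 * anorm (gram i p) v /\
  anorm (gram i p) v <= 5/4 * anorm (gram i (param i y)) v.
Proof.
move=> ip; have pA := gram_psd ip.
have [m m0 mA] := unit_sphere_bound pA (fun v => @gram_definite i p v ip).
pose D y a b := `|gram i (param i y) a b - gram i p a b|.
have Dcvg : (fun y => \sum_a \sum_b D y a b) @ coord i p --> \sum_(a < n) \sum_(b < n) (0 : R).
  have H a b : (fun y => D y a b) @ coord i p --> (0 : R).
    have c1 : (fun y => gram i (param i y) a b) @ coord i p --> gram i p a b.
      rewrite -{2}(coordK ip); exact: gram_continuous.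
    have -> : 0 = `|gram i p a b - gram i p a b| by rewrite subrr normr0.
    exact: (cvg_norm (cvgB c1 (cvg_cst (gram i p a b)))).
  apply: cvg_big; [exact: add_continuous|exact: nbhs_filter|move=> a _].
  by apply: cvg_big; [exact: add_continuous|exact: nbhs_filter|move=> b _; exact: H].
have {}Dcvg : (fun y => \sum_a \sum_b D y a b) @ coord i p --> (0 : R).
  by move: Dcvg; under eq_bigr do rewrite big1_eq; rewrite big1_eq.
have m40 : 0 < m / 4 by rewrite divr_gt0.
have := (@cvgr_lt _ _ _ _ _ _ Dcvg (m / 4) m40) => Dm.
near=> y => v.
have iy : dom i (param i y) by near: y; exact: near_chart_dom.
have pY := gram_psd iy.
have Dy : \sum_a \sum_b D y a b < m / 4 by near: y; exact: Dm.
have Q : `|bform (gram i (param i y)) v v - bform (gram i p) v v| <=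
    4^-1 * bform (gram i p) v v.
  apply: (@le_trans _ _ (m / 4 * eucl_norm v ^+ 2)); last first.
    by have := mA v; lra.
  apply: (@le_trans _ _ ((\sum_a \sum_b D y a b) * eucl_norm v ^+ 2)); last first.
    by rewrite ler_wpM2r ?sqr_ge0 ?ltW.
  exact: bform_dist_le.
have Nle (A B : 'M[R]_n) : psd A -> bform A v v <= 25/16 * bform B v v ->
    anorm A v <= 5/4 * anorm B v.
  move=> qA AB; rewrite /anorm -[5/4](@ger0_norm R) ?divr_ge0//.
  rewrite -sqrtr_sqr -sqrtrM ?sqr_ge0// ler_wsqrtr//.
  by apply: le_trans AB _; lra.
have [Q1 Q2] := quarter_close (pA.2 v) Q.
by split; [exact: Nle pY Q1|exact: Nle pA Q2].
Unshelve. all: by end_near. Qed.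

End charts.

(** * Speed and tangent maps in a chart *)

Section speed.
Variables (R : realType) (n : nat) (M : manifold R n) (g : riemannian_metric M).
Implicit Types (i j : index M) (c : R -> M).

Lemma velocity_chart i c (u : R) (v : 'rV[R]_n) : dom i (c u) ->
  {for u, continuous c} -> is_derive u 1 (coord i \o c) v ->
  velocity c u = chart_vector i (c u) v.
Proof.
move=> iu cu dv; apply/funext => j; rewrite /velocity /chart_vector /family_at.
have [ju|//] := boolP (c u \in dom j); have {}ju := set_mem ju.
have dF : differentiable (coord i \o c) u.
  by apply/derivable1_diffP; exact: ex_derive.
have dg := transition_differentiable iu ju.
have dg' : differentiable (coord j \o param i) ((coord i \o c) u) by exact: dg.
rewrite derive1E.
apply: (@etrans _ _ ('D_1 ((coord j \o param i) \o (coord i \o c)) u)).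
  apply: near_eq_derive.
  have : \forall y \near u, dom i (c y).
    by apply: cu; apply: open_nbhs_nbhs; split => //; exact: dom_open.
  by apply: filterS => y iy /=; rewrite coordK.
have e1 := deriveE (1 : R) (differentiable_comp dF dg').
have e2 := congr1 (fun h => h (1 : R)) (diff_comp dF dg').
have e3 := esym (deriveE (1 : R) dF).
have e4 : 'D_1 (coord i \o c) u = v by exact: derive_val.
transitivity ('d (coord j \o param i) ((coord i \o c) u) ('d (coord i \o c) u (1 : R))).
  exact: (etrans e1 e2).
by rewrite e3 e4.
Qed.

(** The speed of the curve [c], whose integral is its length. *)
Definition speed c (u : R) : R := Num.sqrt (g (c u) (velocity c u) (velocity c u)).

Lemma speed_chart i c (u : R) (v : 'rV[R]_n) : dom i (c u) ->
  {for u, continuous c} -> is_derive u 1 (coord i \o c) v ->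
  speed c u = anorm (gram g i (c u)) v.
Proof.
move=> iu cu dv; rewrite /speed (velocity_chart iu cu dv).
by rewrite inner_chart_vector.
Qed.

(** If on [[s, t]] the norm of [g p] is at most 5/4 times that of the metric
    along [c], the increment of [c] in the chart is at most 5/4 times its length.
    The functional paired with the velocity is the normalised inner product with
    the increment [w] itself. *)
Lemma chart_increment_le i p c (s t : R) : psd (gram g i p) -> s <= t ->
  abs_continuous s t (coord i \o c) ->
  (forall u, s < u < t -> {for u, continuous c}) ->
  (forall u, s <= u <= t -> dom i (c u)) ->
  (forall u, s <= u <= t -> forall v,
     anorm (gram g i p) v <= 5/4 * anorm (gram g i (c u)) v) ->
  ((4/5 * anorm (gram g i p) (coord i (c t) - coord i (c s)))%:E <=
    \int[lebesgue_measure]_(u in `]s, t]) (speed c u)%:E)%E.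
Proof.
move=> pA st acc cc ic gc; set A := gram g i p in pA gc *.
set w := coord i (c t) - coord i (c s).
have speed0 u : (0 <= (speed c u)%:E)%E by rewrite lee_fin sqrtr_ge0.
have [->|w0] := eqVneq (anorm A w) 0.
  by rewrite mulr0; apply: integral_ge0.
have {}w0 : 0 < anorm A w by rewrite lt_neqAle eq_sym w0 anorm_ge0.
pose l := 4/5 / anorm A w.
have l0 : 0 <= l by rewrite divr_ge0// ltW.
have lE (v : 'rV[R]_n) : \sum_k (l * (A *m w^T) k ord0) * v ord0 k = l * bform A v w.
  by rewrite bform_functional mulr_sumr; apply: eq_bigr => k _; rewrite mulrA.
have := @abs_continuous_functional_le R n s t (coord i \o c)
  (fun k => l * (A *m w^T) k ord0) (fun u => (speed c u)%:E) st acc speed0.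
rewrite lE -/w -sqr_anorm// /l expr2 mulrA divfK ?gt_eqF//.
apply=> u v sut dv; rewrite lE lee_fin.
have sut' : s <= u <= t by move/andP : sut => [/ltW -> /ltW ->].
rewrite (speed_chart (ic _ sut') (cc _ sut) dv).
apply: (@le_trans _ _ (l * (anorm A v * anorm A w))).
  by rewrite ler_wpM2l// bform_le_anorm.
rewrite mulrCA /l divfK ?gt_eqF//.
apply: le_trans (ler_wpM2r _ (gc u sut' v)) _; first by rewrite divr_ge0.
rewrite mulrAC mulrA divfK ?pnatr_eq0// mulfV ?mul1r//.
Qed.

(** The hypothesis on the tangent map, homogenised and read in a chart. *)
Lemma tangent_map_onto q (f : 'rV[R]_q -> M) (C0 : R) i (y : 'rV[R]_q) (d : 'rV[R]_n) :
  0 < C0 -> dom i (f y) ->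
  [set xi | tangent_space (f y) xi /\ g (f y) xi xi <= 1]
         `<=` tangent_map f y @` eucl_ball 0 C0%:E ->
  exists2 h, 'd (coord i \o f) y h = d & eucl_norm h <= C0 * anorm (gram g i (f y)) d.
Proof.
move=> C00 iy hdf; set s := anorm _ d.
have pY := gram_psd g iy.
have [d0|d0] := eqVneq d 0.
  exists 0; first by rewrite linear0.
  by rewrite eucl_normE anorm0 mulr_ge0 ?anorm_ge0// ltW.
have s0 : 0 < s.
  rewrite lt_neqAle anorm_ge0 andbT eq_sym; apply: contra d0 => /eqP s0.
  by apply/eqP/(gram_definite (g := g) iy); rewrite -sqr_anorm// -/s s0 expr0n.
have [] := hdf (chart_vector i (f y) (s^-1 *: d)).
  split; first exact: chart_vector_tangent.
  rewrite inner_chart_vector// bformZl bformZr -sqr_anorm// -/s expr2.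
  by rewrite mulKf ?gt_eqF// mulVf ?gt_eqF.
move=> h; rewrite /eucl_ball/= subr0 lte_fin => hC /(congr1 (fun xi => xi i)).
rewrite chart_vectorE// /tangent_map /family_at mem_set// transition_id// => hE.
exists (s *: h).
  by rewrite linearZ/= hE scalerA mulfV ?gt_eqF// scale1r.
by rewrite eucl_normZ gtr0_norm// mulrC ler_wpM2r ?ltW.
Qed.

End speed.

(** * Liftable times *)

Section topology.
Variable R : realType.

Lemma mx_norm_le_eucl_norm n (v : 'rV[R]_n) : `|v| <= eucl_norm v.
Proof.
rewrite /Num.Def.normr/= mx_normrE; apply: bigmax_le => [|[i k] _ /=].
  exact: eucl_norm_ge0.
by rewrite (ord1 i); exact: coord_le_eucl_norm.
Qed.

Lemma nbhs_eucl_ball n (x : 'rV[R]_n) (P : set 'rV[R]_n) : nbhs x P ->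
  exists2 r : R, 0 < r & forall y, eucl_norm (y - x) < r -> P y.
Proof.
move=> /nbhs_ballP[r /= r0 rP]; exists r => // y yr; apply: rP.
rewrite mx_norm_ball /ball_/= distrC.
exact: le_lt_trans (mx_norm_le_eucl_norm _) yr.
Qed.

Lemma near_eucl_ball n (x0 x : 'rV[R]_n) (r : \bar R) : eucl_ball x0 r x ->
  \forall y \near x, eucl_ball x0 r y.
Proof.
case: r => [r| |]; rewrite /eucl_ball/=; last by rewrite ltNge leNye.
  rewrite lte_fin => xr.
  have H := @cvgr_lt _ _ _ _ _ _ (@eucl_dist_continuous R n x0 x) r xr.
  by near=> y; rewrite /eucl_ball/= lte_fin; near: y; exact: H.
by move=> _; apply: (@filterE _ (nbhs x)) => y; rewrite /= ltry.
Unshelve. all: by end_near. Qed.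

Lemma within_itv_near (T : topologicalType) (c : R -> T) (a b t : R) (P : set T) :
  {within `[a, b], continuous c} -> a <= t <= b -> nbhs (c t) P ->
  exists2 d : R, 0 < d & forall u, a <= u <= b -> `|t - u| < d -> P (c u).
Proof.
move=> /subspace_continuousP cc tab cP.
have /nbhs_ballP[d /= d0 dP] := cc t tab P cP.
by exists d => // u uab ud; apply: dP.
Qed.

Lemma within_itv_continuous (T : topologicalType) (c : R -> T) (a b u : R) :
  {within `[a, b], continuous c} -> a < u < b -> {for u, continuous c}.
Proof.
move=> cc aub; have uab : u \in `]a, b[ by rewrite in_itv.
have H : {within `]a, b[, continuous c}.
  by apply: continuous_subspaceW cc; exact: subset_itv_oo_cc.
by move: H; rewrite continuous_open_subspace//; apply; exact/mem_set.
Qed.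

(** The supremum of the liftable times is liftable: lifts [x t] of liftable
    times [t] tending to it have a cluster point in the compact ball of radius
    [K (sup S)]. *)
Lemma lift_set_closed (T : topologicalType) q (c : R -> T) (f : 'rV[R]_q -> T)
    (x0 : 'rV[R]_q) (K : R -> R) :
  hausdorff_space T -> {within `[0, 1], continuous c} ->
  (forall s t, 0 <= s -> s <= t -> t <= 1 -> K s <= K t) ->
  (forall x, eucl_norm (x - x0) <= K 1 -> {for x, continuous f}) ->
  let S := [set t | 0 <= t <= 1 /\
    exists2 x, f x = c t & eucl_norm (x - x0) <= K t] in
  S !=set0 -> S (sup S).
Proof.
move=> hT cc ndK cf S S0.
have ubS : ubound S 1 by move=> t [/andP[]].
have supS : has_sup S by split => //; exists 1.
have s1 : sup S <= 1 by apply: ge_sup.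
have tS t : S t -> t <= sup S by move=> St; apply: ub_le_sup => //; exists 1.
have s0 : 0 <= sup S.
  by case: S0 => t St; apply: le_trans (tS t St); case: St => /andP[].
have s01 : 0 <= sup S <= 1 by rewrite s0 s1.
have /choice[x xP] : forall t, exists y : 'rV[R]_q,
    S t -> f y = c t /\ eucl_norm (y - x0) <= K t.
  move=> t; have [St|St] := pselect (S t); last by exists 0.
  by have [_ [y y1 y2]] := St; exists y.
pose Fs := within S (nbhs (sup S)).
have FsP : ProperFilter Fs.
  apply: within_nbhs_proper; apply: closure_sup => //; by exists 1.
have FB : (x @ Fs) [set y | eucl_norm (y - x0) <= K (sup S)].
  have : nbhs (sup S) [set t | S t -> eucl_norm (x t - x0) <= K (sup S)].
    apply: filterE => t St; have [_ xt] := xP t St; apply: le_trans xt _.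
    by case: (St) => /andP[t0 _] _; apply: ndK => //; exact: tS.
  exact.
have [y [yB yF]] := compact_eucl_ball (fmap_proper_filter x FsP) FB.
split => //; exists y => //; apply: hT => A B Ay Bc.
have cfy : {for y, continuous f}.
  by apply: cf; apply: le_trans yB _; exact: ndK.
have FBc : (x @ Fs) [set z | exists t, [/\ S t, B (c t) & z = x t]].
  have : nbhs (sup S) [set t | S t -> B (c t)].
    move/subspace_continuousP : cc => /(_ _ s01 B Bc) => H.
    have {}H : nbhs (sup S) [set t | `[0, 1]%classic t -> B (c t)] by exact: H.
    by apply: filterS H => t tB St; apply: tB; case: St.
  move=> H; have : nbhs (sup S) [set t | S t -> exists t', [/\ S t', B (c t') & x t = x t']].
    by apply: filterS H => t tB St; exists t; split => //; exact: tB.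
  exact.
have [z [[t [St Bt ->]] fz]] := yF _ _ FBc (cfy _ Ay).
by exists (f (x t)); split => //; have [-> _] := xP t St.
Qed.

End topology.

(** * Lifting the path *)

Lemma continuous_at_preimage (T U : topologicalType) (f : T -> U) x (P : set U) :
  {for x, continuous f} -> nbhs (f x) P -> nbhs x (f @^-1` P).
Proof. by move=> cf; exact: cf. Qed.

(** If [c t = f x] with [t < 1], then [c t' = f z] for some later time [t'] and
    some [z] whose distance to [x] is at most [2 C0] times the length of [c]
    between [t] and [t']. *)
Lemma lift_step (R : realType) (n q : nat) (M : manifold R n)
    (g : riemannian_metric M) (C0 : R) (r0 : \bar R) (hC0 : 0 < C0)
    (x0 : 'rV[R]_q) (f : 'rV[R]_q -> M)
    (hf : map_C1 (eucl_ball x0 r0) f)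
    (hdf : forall x, eucl_ball x0 r0 x ->
       [set xi | tangent_space (f x) xi /\ g (f x) xi xi <= 1]
         `<=` tangent_map f x @` eucl_ball 0 C0%:E)
    (c : R -> M) (t : R) (x : 'rV[R]_q) :
  abs_continuous_path c -> 0 <= t -> t < 1 -> eucl_ball x0 r0 x -> f x = c t ->
  exists t' z, [/\ t < t', t' <= 1, f z = c t' &
    ((eucl_norm (z - x))%:E <=
      (2 * C0)%:E * \int[lebesgue_measure]_(u in `]t, t']) (speed g c u)%:E)%E].
Proof.
move=> [cc acc] t0 t1 xB fxt; set p := f x.
have [i ip] := dom_cover p.
set A := gram g i p.
have pA : psd A := gram_psd g ip.
have A0 v : bform A v v = 0 -> v = 0 := fun H => gram_definite ip H.
pose F := coord i \o f.
have cfx : {for x, continuous f} := hf.1 x xB.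
(* Points where the metric is close to A. *)
pose good (r : M) := dom i r /\ forall v,
  anorm (gram g i r) v <= 5/4 * anorm A v /\ anorm A v <= 5/4 * anorm (gram g i r) v.
have near_good : \forall r \near p, good r.
  have dp : \forall r \near p, dom i r.
    by apply: open_nbhs_nbhs; split => //; exact: dom_open.
  have H := coord_continuous ip (near_gram_le g ip).
  have {}H : \forall r \near p, forall v,
      anorm (gram g i (param i (coord i r))) v <= 5/4 * anorm A v /\
      anorm A v <= 5/4 * anorm (gram g i (param i (coord i r))) v by exact: H.
  near=> r; have ir : dom i r by near: r; exact: dp.
  split => // v; have := coordK ir => E; rewrite -{1 2}E; move: v; near: r; exact: H.
have [rho rho0 ballP] : exists2 rho : R, 0 < rho & forall y,
    eucl_norm (y - x) < rho -> eucl_ball x0 r0 y /\ good (f y).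
  have good_f : nbhs x (f @^-1` good) := continuous_at_preimage cfx near_good.
  exact: (nbhs_eucl_ball (filterI (near_eucl_ball xB) good_f)).
(* Any constant strictly between 5/4 C0 and 8/5 C0 would do. *)
pose k := 3/2 * C0.
have k0 : 0 < k by rewrite /k mulr_gt0// divr_gt0.
have near_target : \forall r \near p, k * anorm A (coord i r - F x) < rho.
  have cN : (fun r : M => k * anorm A (coord i r - F x)) @ p --> (0 : R).
    have c1 := coord_continuous ip.
    have H := cvg_comp _ _ (cvgB c1 (cvg_cst (F x))) (@anorm_continuous R n A _).
    have E : anorm A (coord i p - F x) = 0 by rewrite /F/= subrr anorm0.
    have {}H : (fun r : M => anorm A (coord i r - F x)) @ p --> anorm A (coord i p - F x).
      exact: H.
    rewrite E in H; rewrite -(mulr0 k); exact: (cvgM (cvg_cst k) H).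
  exact: (@cvgr_lt _ _ _ _ _ _ cN rho rho0).
have t01 : 0 <= t <= 1 by rewrite t0 ltW.
have cP : nbhs (c t) [set r | good r /\ k * anorm A (coord i r - F x) < rho].
  by rewrite -fxt; exact: filterI near_good near_target.
have [d d0 dP] := within_itv_near cc t01 cP.
(* On [t, t'] the path stays where the chart estimates hold. *)
pose t' := Num.min 1 (t + d / 2).
have d20 : 0 < d / 2 by rewrite divr_gt0.
have tt' : t < t' by rewrite /t' lt_min t1/= ltrDl.
have t'1 : t' <= 1 by rewrite /t' ge_min lexx.
have t'd : t' <= t + d / 2 by rewrite /t' ge_min lexx orbT.
have P u : t <= u <= t' -> good (c u) /\ k * anorm A (coord i (c u) - F x) < rho.
  move=> /andP[tu ut']; apply: dP.
    by rewrite (le_trans t0 tu) (le_trans ut' t'1).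
  rewrite distrC ger0_norm ?subr_ge0//.
  by have := le_trans ut' t'd; move: d20; clear; lra.
set w := coord i (c t').
have [[ict' _] kw] : good (c t') /\ k * anorm A (w - F x) < rho.
  by apply: P; rewrite lexx ltW.
have [z Fz zx] : exists2 z, F z = w & eucl_norm (z - x) <= k * anorm A (w - F x).
  apply: (local_covering (L := 5/4 * C0) pA A0).
  - by rewrite mulr_ge0 ?divr_ge0 ?ltW.
  - by rewrite /k ltr_pM2r//; lra.
  move=> y yx; have [yB [iy gy]] := ballP y (le_lt_trans yx kw).
  split.
    by apply: (hf.2 i).1; split.
  move=> v; have [h hE hn] := tangent_map_onto v hC0 iy (hdf y yB).
  exists h; first exact: hE.
  apply: le_trans hn _; rewrite [5/4 * C0]mulrC -mulrA ler_pM2l; last exact: hC0.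
  exact: (gy v).1.
have [zB [iz _]] := ballP z (le_lt_trans zx kw).
exists t', z; split; [exact: tt'|exact: t'1| |].
  rewrite -(coordK iz); apply: etrans (congr1 (param i) Fz) _; exact: coordK.
have seg : ((4/5 * anorm A (w - F x))%:E <=
    \int[lebesgue_measure]_(u in `]t, t']) (speed g c u)%:E)%E.
  have -> : F x = coord i (c t) by rewrite -fxt.
  apply: chart_increment_le.
  - exact: pA.
  - exact: ltW.
  - by apply: acc t0 (ltW tt') t'1 _ => u /P[[]].
  - move=> u /andP[tu ut']; apply: (within_itv_continuous cc).
    by rewrite (le_lt_trans t0 tu) (lt_le_trans ut' t'1).
  - by move=> u /P[[]].
  - by move=> u /P[[_ H] _] v; have [] := H v.
apply: le_trans (lee_wpmul2l _ seg); last by rewrite lee_fin mulr_ge0 ?ltW.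
rewrite -EFinM lee_fin; apply: le_trans zx _; rewrite /k.
move: (anorm_ge0 A (w - F x)) hC0; move: (anorm A (w - F x)) => a; clear => a0 C00.
nra.
Unshelve. all: by end_near. Qed.

Theorem theorem1p1 (R : realType) (n q : nat) (M : manifold R n)
    (g : riemannian_metric M) (C0 : R) (r0 : \bar R)
    (hC0 : 0 < C0) (hr0 : (0 < r0)%E)
    (x0 : 'rV[R]_q) (f : 'rV[R]_q -> M)
    (hf : map_C1 (eucl_ball x0 r0) f)
    (hdf : forall x, eucl_ball x0 r0 x ->
       [set xi | tangent_space (f x) xi /\ g (f x) xi xi <= 1]
         `<=` tangent_map f x @` eucl_ball 0 C0%:E) :
  riemannian_ball g (f x0) (r0 * ((2 * C0)^-1)%:E)%E
    `<=` f @` eucl_ball x0 r0.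
Proof.
move=> y /ereal_inf_lt[_ [c [cAC c0 c1] <-] cr].
have C20 : 0 < 2 * C0 by rewrite mulr_gt0.
have speed0 u : (0 <= (speed g c u)%:E)%E by rewrite lee_fin sqrtr_ge0.
pose I (t : R) : \bar R := (\int[lebesgue_measure]_(u in `[0%R, t]) (speed g c u)%:E)%E.
have I0 t : (0 <= I t)%E by apply: integral_ge0.
have leI s t : s <= t -> (I s <= I t)%E.
  move=> st; apply: ge0_subset_integral_nomeas => //.
  by apply: subset_itvl; rewrite bnd_simp.
have I1 : (I 1%R < +oo)%E by apply: lt_le_trans cr _; exact: leey.
have Ifin t : t <= 1 -> I t \is a fin_num.
  by move=> t1; rewrite ge0_fin_numE// (le_lt_trans (leI _ _ t1)).
pose K t := 2 * C0 * fine (I t).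
have ndK s t : 0 <= s -> s <= t -> t <= 1 -> K s <= K t.
  move=> _ st t1; rewrite /K ler_pM2l//; apply: fine_le; last exact: leI.
    exact/Ifin/le_trans/t1.
  exact: Ifin.
have K1 : ((K 1)%:E < r0)%E.
  rewrite /K EFinM fineK ?Ifin//.
  move: cr; rewrite -[path_length g c]/(I 1%R); clear -C20 hr0 => cr.
  by rewrite muleC -lte_pdivlMr.
have ballK x t : t <= 1 -> 0 <= t -> eucl_norm (x - x0) <= K t -> eucl_ball x0 r0 x.
  move=> t1 t0 xK; apply: le_lt_trans K1; rewrite lee_fin (le_trans xK)//.
  exact: ndK.
pose S := [set t | 0 <= t <= 1 /\ exists2 x, f x = c t & eucl_norm (x - x0) <= K t].
have S0 : S 0.
  split; first by rewrite lexx ler01.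
  exists x0; first by rewrite c0.
  by rewrite subrr eucl_normE anorm0 mulr_ge0 ?fine_ge0// ltW.
have [/andP[s0 s1] [x fx xK]] : S (sup S).
  apply: (lift_set_closed (@hausdorff_carrier R n M) cAC.1 ndK); last by exists 0.
  by move=> x xK; apply: hf.1; exact: (ballK x 1).
have xB := ballK x _ s1 s0 xK.
suff sE : sup S = 1 by exists x => //; rewrite fx sE.
apply/eqP; rewrite eq_le s1/= leNgt; apply/negP => s1'.
have [t' [z [st' t'1 fz zx]]] := lift_step hC0 hf hdf cAC s0 s1' xB fx.
suff St' : S t'.
  have : t' <= sup S by apply: ub_le_sup => //; exists 1 => t [/andP[]].
  by rewrite leNgt st'.
have t'0 : 0 <= t' by apply: le_trans (ltW st').
split; first by rewrite t'0.
exists z => //; have -> : z - x0 = (x - x0) + (z - x) by rewrite [RHS]addrC addrA subrK.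
apply: le_trans (ler_eucl_normD _ _) _.
(* The length on [0, t'] is at least the sum of those on [0, sup S] and
   ]sup S, t']. *)
have IJ : (I (sup S) + \int[lebesgue_measure]_(u in `](sup S), t']) (speed g c u)%:E
    <= I t')%E.
  have -> : I t' = (\int[lebesgue_measure]_(u in `[0%R, sup S] `|` `](sup S), t'])
      (speed g c u)%:E)%E.
    congr integral; rewrite -itv_bndbnd_setU ?bnd_simp//; exact: ltW.
  apply: ge0_integral_superadditive => //.
  apply/disj_set2P/seteqP; split => // u /= [].
  by rewrite !in_itv/= => /andP[_ us] /andP[su _]; rewrite ltNge us in su.
set J := (\int[lebesgue_measure]_(u in _) _)%E in zx IJ.
have J0 : (0 <= J)%E by apply: integral_ge0.
have Jfin : J \is a fin_num.
  rewrite ge0_fin_numE//; apply: le_lt_trans I1; apply: le_trans (leI _ _ t'1).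
  by apply: le_trans IJ; rewrite leeDr.
have Isfin := Ifin _ s1; have Itfin := Ifin _ t'1.
rewrite -(fineK Jfin) -EFinM lee_fin in zx.
rewrite -(fineK Jfin) -(fineK Isfin) -(fineK Itfin) -EFinD lee_fin in IJ.
apply: le_trans (lerD xK zx) _.
by rewrite /K -mulrDr ler_pM2l.
Qed.
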